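(* There is an absolute constant $C>0$ such that the following holds. Let $\mathcal{C}$ be a collection of $\ell \geq 2$ non-self-crossing curves in the plane $\mathbb{R}^2$, any two of which meet in finitely many points, and let $\mathcal{P}$ be a set of $p$ points in $\mathbb{R}^2$. Let $m_1$ be the maximum, over all pairs of distinct points $p_1,p_2 \in \mathcal{P}$, of the number of curves in $\mathcal{C}$ passing through both $p_1$ and $p_2$, and let $$m_2 := \binom{\ell}{2}^{-1} \sum_{\{c_1,c_2\} \subseteq \mathcal{C}} |c_1 \cap c_2|$$ be the average intersection multiplicity of pairs of distinct curves. Let $I$ be the number of incidences, i.e. the number of pairs $(q,c) \in \mathcal{P}\times\mathcal{C}$ with $q \in c$. Then $$I \leq C\left( (m_1 m_2)^{1/3} (p \ell)^{2/3} + \ell + m_1 p\right).$$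
   Context: A non-self-crossing curve is a curve in the plane (continuous image of an interval) that does not cross itself. *)

(* Defs.v *)
From HB Require Import structures.
From mathcomp Require Import all_boot all_order all_algebra finmap.
From mathcomp Require Import all_classical all_reals all_analysis.
Set Implicit Arguments.
Unset Strict Implicit.
Unset Printing Implicit Defensive.
Import Order.TTheory GRing.Theory Num.Theory.
Import numFieldNormedType.Exports.
Local Open Scope classical_set_scope.
Local Open Scope ring_scope.
Local Open Scope fset_scope.

(* The interval may be open, closed or half-open, bounded or not. "Does not
   cross itself" is injectivity of the parametrization: no point is visited
   twice. Simple closed curves are included: they are injective images of
   half-open intervals. *)
Definition non_self_crossing_curve (R : realType) (c : set (R * R)) : Prop :=
  exists (J : set R) (g : R -> R * R),
    [/\ is_interval J, {within J, continuous g}, set_inj J g & c = (g @` J)%classic].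

(* The maximum over an empty family of pairs (at most one point) is 0. *)
Definition max_joint_curves (R : realType)
    (C : {fset set (R * R)}) (P : {fset R * R}) : nat :=
  \max_(x <- P `*` P | x.1 != x.2)
     #|` [fset c in C | (x.1 \in c) && (x.2 \in c)] |.

(* [fset_set A] is A for a finite set A, and is empty otherwise, so the sum is
   meaningful when distinct curves meet in finitely many points. *)
Definition avg_intersection (R : realType) (C : {fset set (R * R)}) : R :=
  ('C(#|` C|, 2)%:R)^-1 *
  \sum_(D <- fpowerset C | #|` D| == 2%N)
     #|` fset_set (\bigcap_(c in [set` D]) c)%classic |%:R.

Definition incidences (R : realType)
    (C : {fset set (R * R)}) (P : {fset R * R}) : nat :=
  #|` [fset x in P `*` C | x.1 \in x.2] |.

(* Main.v *)
(* Consecutive points of [P] on a curve bound an arc, so the curves cut out a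
   drawn multigraph with at least [I - l] edges and multiplicity at most [m1],
   and Szekely's crossing number argument applies. Only crossings of arcs
   without a common end are counted: such arcs lie on different curves and meet
   outside [P], so there are at most [sum |c1 /\ c2|] of them.

   The crossing lemma needs a linear bound on the number of edges of a graph in
   which independent edges do not meet. Such a graph has no [K5] minor, and a
   graph without [K5] minor on [n] vertices has at most [7 n] edges. That five
   points cannot be joined pairwise so that independent connections stay apart
   is the van Kampen obstruction: after a perturbation the connections are
   polygonal chains in general position, and the number of crossings between
   independent chains does not change modulo 2 when every chain is replaced by
   a segment; for segments joining five points it is odd. *)
Require Import Defs.
From HB Require Import structures.
From mathcomp Require Import all_boot all_order all_algebra finmap.
From mathcomp Require Import all_classical all_reals all_analysis.
From mathcomp Require Import ring lra zify.
Set Implicit Arguments.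
Unset Strict Implicit.
Unset Printing Implicit Defensive.
Import Order.TTheory GRing.Theory Num.Theory.
Import numFieldNormedType.Exports.
Local Open Scope ring_scope.

(** * The crossing lemma for multigraphs *)

(** Euler's formula would need the faces of a drawing, hence the Jordan curve theorem, for arcs that
    are merely continuous and that may meet again after a common end. The K5 obstruction needs no
    faces: it only asks which independent pairs meet. Arcs enter through finite chains of points on
    them. Disjoint arcs are compact, hence some [r] apart, and chains with steps at most [r / 8] on
    disjoint arcs stay too far apart to cross, even after the perturbation. Chains can be
    concatenated inside branch sets, so a K5 minor turns into ten chains, and chains for disjoint
    pairs of branch sets run along edges without a common end. The constant 7 is [2 ^ 3 - 1]:
    excluding K2, K3, K4, K5 as minors allows at most 0, 1, 3, 7 edges per vertex, each value being
    twice the previous one plus 1. *)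

Section RandomSubset.
Variables (R : realFieldType) (U : finType) (w : U -> R).

(** The law of a random subset that keeps each [i] independently with probability [w i]. *)
Definition weight (A : {set U}) : R :=
  \prod_i (if i \in A then w i else 1 - w i).

Lemma weight_ge0 A : (forall i, 0 <= w i <= 1) -> 0 <= weight A.
Proof.
move=> w01; apply: prodr_ge0 => i _; case: ifP => _; have := w01 i; lra.
Qed.

(** The product over [U] of [w i + (1 - w i)], with the second summand replaced by 0 on [T], expands
    into one term per subset; the terms of sets missing a point of [T] vanish. *)
Lemma sum_weight (T : {set U}) :
  \sum_(A : {set U}) weight A * (T \subset A)%:R = \prod_(i in T) w i.
Proof.
transitivity (\prod_i (w i + (if i \in T then 0 else 1 - w i))); last first.
  rewrite [RHS]big_mkcond; apply: eq_bigr => i _; case: ifP => _; first by rewrite addr0.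
  by rewrite addrC subrK.
rewrite bigA_distr; apply: eq_big => [A|A _]; first by rewrite inE.
case: (boolP (T \subset A)) => [TA|]; last first.
  case/subsetPn => i iT iA; rewrite mulr0; apply/esym.
  by rewrite (bigD1 i) //= (negPf iA) iT mul0r.
rewrite mulr1; apply: eq_bigr => i _; case: ifP => // iA.
by case: ifP => // /(fintype.subsetP TA); rewrite iA.
Qed.

(** Linearity of expectation for the number of sets [T i] that survive. *)
Lemma sum_weight_count (I : finType) (T : I -> {set U}) (Q : pred I) :
  \sum_(A : {set U}) weight A * #|[pred i | Q i && (T i \subset A)]|%:R =
  \sum_(i | Q i) \prod_(u in T i) w u.
Proof.
rewrite -(eq_bigr _ (fun i _ => sum_weight (T i))) exchange_big /=.
apply: eq_bigr => A _; rewrite -mulr_sumr; congr (_ * _).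
rewrite -sum1_card natr_sum [RHS]big_mkcond /= big_mkcond /=.
by apply: eq_bigr => i _; rewrite !inE; case: (Q i); case: (T i \subset A).
Qed.

End RandomSubset.

Section CrossingLemma.
Variables (V E : finType) (s t : E -> V) (cross : rel E).

Definition disjoint_ends (e f : E) :=
  [&& s e != s f, s e != t f, t e != s f & t e != t f].

Definition parallel (e f : E) :=
  ((s e == s f) && (t e == t f)) || ((s e == t f) && (t e == s f)).

(** Deleting every edge of a crossing or parallel pair leaves [F'], to which the planar bound
    applies. A deleted [e] is charged to the ordered pair of [e] and one culprit [g e]; the first
    entry tells these pairs apart. *)
Lemma planar_deletion (S : {set V}) (F : {set E}) :
  (forall F' : {set E}, F' \subset F ->
    {in F' &, forall e f, e != f -> ~~ cross e f && ~~ parallel e f} ->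
    (#|F'| <= 7 * #|S|)%N) ->
  (#|F| <= 7 * #|S|
     + #|[pred x : E * E | (x.1 \in F) && (x.2 \in F) && cross x.1 x.2]|
     + #|[pred x : E * E | (x.1 \in F) && (x.2 \in F) && ((x.1 != x.2) && parallel x.1 x.2)]|)%N.
Proof.
move=> planarF.
pose bad e f := (e != f) && (cross e f || parallel e f).
pose F' := [set e in F | [forall f in F, ~~ bad e f]]%SET.
have sF' : F' \subset F by apply/fintype.subsetP => e; rewrite inE => /andP[].
rewrite -addnA -(cardsID F' F) (finset.setIidPr sF').
apply: leq_add.
  apply: planarF => // e f; rewrite !inE => /andP[_ /forall_inP He] /andP[fF _] ef.
  by have := He f fF; rewrite /bad ef negb_or.
rewrite -cardUI.
pose g e := odflt e [pick f in F | bad e f].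
have gP e : e \in F :\: F' -> (g e \in F) && bad e (g e).
  rewrite !inE => /andP[nb eF]; move: nb; rewrite eF /= => /forall_inPn[f fF].
  rewrite negbK => bf; rewrite /g; case: pickP => /= [f' /andP[-> ->] //|].
  by move=> /(_ f); rewrite /= fF bf.
apply: leq_trans _ (leq_addr _ _).
have g_inj : {in F :\: F' &, injective (fun e => (e, g e))} by move=> e f _ _ /(congr1 fst).
rewrite -(card_in_image g_inj).
apply: subset_leq_card; apply/fintype.subsetP => _ /fintype.imageP[e eF ->].
have := gP e eF; rewrite /bad !inE /= => /andP[-> /andP[-> /orP b]].
move: eF; rewrite inE => /andP[_ ->] /=.
by apply/orP; case: b => ->; [left|right].
Qed.

(* Vertices are kept with probability [p] and edges with probability [q]; with
   [q = 1 / (2 m)] at most half of the expected number of edges is lost to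
   parallel pairs, and [p] makes the linear term half of what is left. *)
Lemma crossing_lemma (R : realFieldType) (D : {set E}) (m : nat) :
  {in D, forall e, s e != t e} ->
  (forall e f, cross e f -> disjoint_ends e f) ->
  {in D, forall e, (#|[pred f in D | parallel e f]| <= m)%N} ->
  (forall (S : {set V}) (F : {set E}), F \subset D ->
    {in F, forall e, (s e \in S) && (t e \in S)} ->
    {in F &, forall e f, e != f -> ~~ cross e f && ~~ parallel e f} ->
    (#|F| <= 7 * #|S|)%N) ->
  (56 * m * #|V| < #|D|)%N ->
  (#|D| ^ 3 <= 19 ^ 3 * m * #|V| ^ 2 *
     #|[pred x : E * E | (x.1 \in D) && (x.2 \in D) && cross x.1 x.2]|)%N.
Proof.
move=> noloop crossP mult planar big.
set cr := #|[pred x : E * E | _]|.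
have [e0 e0D] : exists e, e \in D by apply/card_gt0P; apply: leq_ltn_trans big.
have m0 : (0 < m)%N.
  apply: leq_trans (mult _ e0D); apply/card_gt0P; exists e0.
  by rewrite !inE e0D /parallel !eqxx.
have n0 : (0 < #|V|)%N by apply/card_gt0P; exists (s e0).
set n := #|V| in big n0 *; set e := #|D| in big *.
have e_gt0 : (0 < e)%N by apply: leq_ltn_trans big.
pose p : R := 56 * n%:R * m%:R / e%:R; pose q : R := (2 * m%:R)^-1.
have mR : (0 : R) < m%:R by rewrite ltr0n.
have m1R : (1 : R) <= m%:R by rewrite ler1n.
have nR : (0 : R) < n%:R by rewrite ltr0n.
have eR : (0 : R) < e%:R by rewrite ltr0n.
have p0 : 0 < p by rewrite divr_gt0 // !mulr_gt0.
have p1 : p <= 1.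
  by rewrite ler_pdivrMr // mul1r -!natrM ler_nat mulnAC ltnW.
have q0 : 0 < q by rewrite invr_gt0 mulr_gt0.
have q1 : q <= 1 by rewrite invf_le1 ?mulr_gt0 //; lra.
(* Vertices and edges are sampled together, as one random subset of [V + E]; an edge survives when
   it and both its ends are kept. *)
pose w (u : V + E) := if u is inl _ then p else q.
have w01 u : 0 <= w u <= 1 by case: u => ? /=; rewrite ?(ltW p0) ?(ltW q0) ?p1.
pose T e : {set V + E} := [set inl (s e); inl (t e); inr e]%SET.
have wT e1 : e1 \in D -> \prod_(u in T e1) w u = p ^+ 2 * q.
  move=> e1D; transitivity (\prod_(u <- [:: inl (s e1); inl (t e1); inr e1]) w u).
    rewrite big_uniq /=; last first.
      by rewrite !inE !negb_or !(inj_eq inl_inj) noloop.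
    by apply: eq_bigl => u; rewrite !inE orbA.
  by rewrite !big_cons big_nil /=; ring.
(* Crossing edges are independent, so they have four ends, whence [p ^+ 4]; parallel edges have only
   two. *)
have wcross x : x.1 \in D -> x.2 \in D -> cross x.1 x.2 ->
    \prod_(u in T x.1 :|: T x.2) w u = p ^+ 4 * q ^+ 2.
  case: x => a b /= aD bD ab; have /and4P[h1 h2 h3 h4] := crossP _ _ ab.
  have nab : a != b by apply: contraNneq h1 => ->.
  transitivity (\prod_(u <- [:: inl (s a); inl (t a); inr a; inl (s b); inl (t b); inr b]) w u).
    rewrite big_uniq /=; last first.
      rewrite !inE !negb_or !(inj_eq inl_inj) !(inj_eq inr_inj).
      by rewrite !noloop // h1 h2 h3 h4 nab.
    by apply: eq_bigl => u; rewrite !inE -!orbA.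
  by rewrite !big_cons big_nil /=; ring.
have wpar x : x.1 \in D -> x.2 \in D -> x.1 != x.2 -> parallel x.1 x.2 ->
    \prod_(u in T x.1 :|: T x.2) w u = p ^+ 2 * q ^+ 2.
  case: x => a b /= aD bD nab ab.
  transitivity (\prod_(u <- [:: inl (s a); inl (t a); inr a; inr b]) w u).
    rewrite big_uniq /=; last first.
      rewrite !inE !negb_or !(inj_eq inl_inj) !(inj_eq inr_inj).
      by rewrite !noloop // nab.
    apply: eq_bigl => u; rewrite !inE -!orbA.
    move: ab; rewrite /parallel => /orP[]/andP[/eqP-> /eqP->];
      by do 6 case: (u == _).
  by rewrite !big_cons big_nil /=; ring.
have ineq (A : {set V + E}) :
   (#|[pred e1 | (e1 \in D) && (T e1 \subset A)]| <=
    7 * #|[pred v : V | xpredT v && ([set inl v]%SET \subset A)]|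
    + #|[pred x : E * E | [&& x.1 \in D, x.2 \in D & cross x.1 x.2] && (T x.1 :|: T x.2 \subset A)]|
    + #|[pred x : E * E | [&& x.1 \in D, x.2 \in D, x.1 != x.2 & parallel x.1 x.2] && (T
      x.1 :|: T x.2 \subset A)]|)%N.
  pose S := [set v | inl v \in A]%SET.
  pose F := [set e1 in D | T e1 \subset A]%SET.
  have planarF (F' : {set E}) : F' \subset F ->
      {in F' &, forall e1 f, e1 != f -> ~~ cross e1 f && ~~ parallel e1 f} ->
      (#|F'| <= 7 * #|S|)%N.
    move=> F'F; apply: planar.
      by apply: fintype.subset_trans F'F _; apply/fintype.subsetP => e1; rewrite inE => /andP[].
    move=> e1 /(fintype.subsetP F'F); rewrite inE => /andP[_ /fintype.subsetP sub].
    by rewrite !inE !sub // !inE eqxx ?orbT.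
  have := planar_deletion planarF.
  have -> : #|F| = #|[pred e1 | (e1 \in D) && (T e1 \subset A)]|.
    by apply: eq_card => e1; rewrite !inE.
  have -> : #|S| = #|[pred v : V | xpredT v && ([set inl v]%SET \subset A)]|.
    by apply: eq_card => v; rewrite !inE finset.sub1set.
  set c3 := #|[pred x | _ && cross _ _]|; set c4 := #|[pred x | _ && (_ && parallel _ _)]|.
  have -> : c3 = #|[pred x : E * E | [&& x.1 \in D, x.2 \in D & cross x.1 x.2] && (T x.1
    :|: T x.2 \subset A)]|.
    apply: eq_card => x; rewrite !inE finset.subUset.
    by case: (x.1 \in D); case: (x.2 \in D); case: (T x.1 \subset A); case: (T x.2 \subset
      A); case: cross.
  have -> : c4 = #|[pred x : E * E | [&& x.1 \in D, x.2 \in D, x.1 != x.2 & parallel x.1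
    x.2] && (T x.1 :|: T x.2 \subset A)]|.
    apply: eq_card => x; rewrite !inE finset.subUset.
    by case: (x.1 \in D); case: (x.2 \in D); case: (T x.1 \subset A); case: (T x.2 \subset
      A); case: (_ != _); case: parallel.
  by [].
have main : p ^+ 2 * q * e%:R <= 7 * (p * n%:R) + p ^+ 4 * q ^+ 2 * cr%:R
    + p ^+ 2 * q ^+ 2 * (m * e)%:R.
  have : \sum_(A : {set V + E}) weight w A * #|[pred e1 | (e1 \in D) && (T e1 \subset A)]|%:R
    <= 7 * (\sum_(A : {set V + E}) weight w A * #|[pred v : V | xpredT v && ([set inl
      v]%SET \subset A)]|%:R)
    + (\sum_(A : {set V + E}) weight w A * #|[pred x : E * E | [&& x.1 \in D, x.2 \in D &
      cross x.1 x.2] && (T x.1 :|: T x.2 \subset A)]|%:R)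
    + (\sum_(A : {set V + E}) weight w A * #|[pred x : E * E | [&& x.1 \in D, x.2 \in D,
      x.1 != x.2 & parallel x.1 x.2] && (T x.1 :|: T x.2 \subset A)]|%:R).
    rewrite mulr_sumr -!big_split /=; apply: ler_sum => A _.
    rewrite mulrCA -!mulrDr; apply: ler_wpM2l; first exact: weight_ge0.
    by rewrite -natrM -!natrD ler_nat.
  rewrite !sum_weight_count.
  rewrite (eq_bigr _ wT) sumr_const -[_ *+ #|D|]mulr_natr => /le_trans; apply.
  rewrite (eq_bigr (fun=> p)) => [|v _]; last by rewrite big_set1.
  rewrite sumr_const -[p *+ _]mulr_natr; apply: lerD; first apply: lerD => //.
    rewrite (eq_bigr (fun=> p ^+ 4 * q ^+ 2)) => [|x /and3P[]]; last exact: wcross.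
    rewrite sumr_const -[p ^+ _ * _ *+ _]mulr_natr; apply: ler_wpM2l; rewrite ?ler_nat.
      by rewrite mulr_ge0 ?exprn_ge0 // ltW.
    apply: eq_leq; apply: eq_card => x; rewrite unfold_in /= !inE.
    by case: (x.1 \in D).
  rewrite (eq_bigr (fun=> p ^+ 2 * q ^+ 2)) => [|x /and4P[]]; last exact: wpar.
  rewrite sumr_const -[p ^+ _ * _ *+ _]mulr_natr; apply: ler_wpM2l; rewrite ?ler_nat.
      by rewrite mulr_ge0 ?exprn_ge0 // ltW.
  rewrite -sum1_card (eq_bigl (fun x : E * E => (x.1 \in D) && ([&& x.2 \in D, x.1 != x.2
    & parallel x.1 x.2]))) //.
  rewrite -(pair_big_dep (mem D) (fun a b => [&& b \in D, a != b & parallel a b]) (fun _ _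
    => 1%N)) /=.
  rewrite mulnC -sum_nat_const; apply: leq_sum => a aD.
  rewrite sum1_card; apply: leq_trans (mult a aD); apply: subset_leq_card.
  by apply/fintype.subsetP => b; rewrite !inE => /and3P[-> _ ->].
have qm : q * m%:R = 2^-1 by rewrite /q; field; rewrite gt_eqF.
have pe : p * e%:R = 56 * n%:R * m%:R by rewrite /p divfK // gt_eqF.
have h1 : p * (q * e%:R) <= 14 * n%:R + 2 * p ^+ 3 * q ^+ 2 * cr%:R.
  rewrite -(ler_pM2l p0); move: main.
  have -> : p ^+ 2 * q ^+ 2 * (m * e)%:R = p ^+ 2 * q * e%:R / 2.
    by rewrite natrM -qm; ring.
  move=> main; have : p ^+ 2 * q * e%:R / 2 <= 7 * (p * n%:R) + p ^+ 4 * q ^+ 2 * cr%:R by lra.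
  have -> : p * (p * (q * e%:R)) = 2 * (p ^+ 2 * q * e%:R / 2) by field.
  have -> : p * (14 * n%:R + 2 * p ^+ 3 * q ^+ 2 * cr%:R) = 2 * (7 * (p * n%:R) + p ^+ 4 *
    q ^+ 2 * cr%:R) by ring.
  by rewrite ler_pM2l.
have h2 : 14 * n%:R <= 2 * p ^+ 3 * q ^+ 2 * cr%:R.
  suff : p * (q * e%:R) = 28 * n%:R by lra.
  have -> : p * (q * e%:R) = q * (p * e%:R) by ring.
  have -> : q * (p * e%:R) = 56 * n%:R * (q * m%:R) by rewrite pe; ring.
  by rewrite qm; field.
rewrite -(ler_nat R) natrX 3!natrM !natrX.
have h3 : 14 * n%:R * (e%:R ^+ 3 * m%:R ^+ 2) <= 2 * (p * e%:R) ^+ 3 * (q * m%:R) ^+ 2 * cr%:R.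
  have -> : 2 * (p * e%:R) ^+ 3 * (q * m%:R) ^+ 2 * cr%:R = 2 * p ^+ 3 * q ^+ 2 * cr%:R *
    (e%:R ^+ 3 * m%:R ^+ 2) by ring.
  by rewrite ler_wpM2r // mulr_ge0 // exprn_ge0 // ltW.
have c0 : 0 < 14 * n%:R * m%:R ^+ 2 :> R by rewrite !mulr_gt0 ?exprn_gt0.
rewrite -(ler_pM2l c0); have -> : 14 * n%:R * m%:R ^+ 2 * e%:R ^+ 3 =
  14 * n%:R * (e%:R ^+ 3 * m%:R ^+ 2) :> R by ring.
apply: (le_trans h3); rewrite pe qm -subr_ge0.
(* Here [8218 = 14 * 19 ^ 3 - 56 ^ 3 / 2]. The computation yields [e ^ 3 <= 6272 * m * n ^ 2 * cr],
   and 19 is the least integer whose cube exceeds 6272. *)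
set X := (X in 0 <= X).
have -> : X = 8218 * (n%:R ^+ 3 * m%:R ^+ 3 * cr%:R) by rewrite /X; field.
by rewrite !mulr_ge0 ?exprn_ge0 ?ler0n.
Qed.

End CrossingLemma.

(** * Graphs without a K5 minor have linearly many edges *)

Section Mader.
Variable V : finType.
Implicit Types (S T : {set V}) (r : rel V) (Q : {set V} -> rel V -> Prop).

Definition nbhd S r x : {set V} := [set y in S | r x y]%SET.

Definition contract r x y : rel V := fun u v =>
  (u != v) && [|| r u v, (u == x) && r y v | (v == x) && r u y].

Definition cone r x : rel V := fun u v =>
  if (u == x) || (v == x) then u != v else r u v.

Definition subgraph_closed Q := forall S S' r r',
  S' \subset S -> {in S' &, subrel r' r} -> Q S r -> Q S' r'.

Definition contract_closed Q := forall S r x y,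
  x \in S -> y \in S -> r x y -> Q S r -> Q (S :\ y) (contract r x y).

Definition clique T r := {in T &, forall x y, x != y -> r x y}.

(** The apex enlarges every clique by one vertex, so a clique size excluded from [Q] drops by one in
    [coned Q]. The induction on this size therefore has to range over classes [Q]. *)
Definition coned Q S r := exists2 x, x \notin S & Q (x |: S) (cone r x).

Lemma coned_subgraph Q : subgraph_closed Q -> subgraph_closed (coned Q).
Proof.
move=> sQ S S' r r' sub rr' [x xS QS]; exists x; first exact: contra (fintype.subsetP sub x) xS.
apply: sQ QS; first exact: finset.setUS.
move=> u v; rewrite !inE /cone => /predU1P[->|uS] /predU1P[->|vS]; rewrite ?eqxx ?orbT //.
by case: ifP => // _; apply: rr'.
Qed.

(** Up to passing to a subgraph, contracting an edge away from the apex commutes with forming the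
    cone. *)
Lemma coned_contract Q :
  subgraph_closed Q -> contract_closed Q -> contract_closed (coned Q).
Proof.
move=> sQ cQ S r z y zS yS rzy [x xS QS].
have nx u : u \in S -> (u == x) = false by apply: contraTF => /eqP->.
exists x; first by rewrite !inE negb_and xS orbT.
have := cQ _ _ z y _ _ _ QS; rewrite !inE zS yS !orbT /cone !nx //= => /(_ isT isT rzy).
apply: sQ => [|u v].
  by apply/fintype.subsetP => u; rewrite !inE => /predU1P[->|/andP[-> ->]];
    rewrite ?orbT // eqxx eq_sym nx.
rewrite !inE /contract /cone => /predU1P[->|/andP[uy uS]] /predU1P[->|/andP[vy vS]];
  rewrite ?eqxx ?orbT ?nx //=.
by move=> ->.
Qed.

Lemma contract_sym r x y : symmetric r -> symmetric (contract r x y).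
Proof.
move=> symr u v; rewrite /contract eq_sym (symr u v) (symr y) (symr u y).
by rewrite [_ || (_ && r y u)]orbC.
Qed.

(** A vertex adjacent to [y] alone gets [x] in exchange; only a common neighbour of [x] and [y]
    loses one. *)
Lemma degree_contract S r x y u : symmetric r -> irreflexive r ->
  x \in S -> u \in S -> u != x -> y != x ->
  (#|nbhd S r u| <= #|nbhd (S :\ y) (contract r x y) u| + (r x u && r y u))%N.
Proof.
move=> symr irr xS uS ux yx.
have sub : nbhd S r u :\ y \subset nbhd (S :\ y) (contract r x y) u.
  apply/fintype.subsetP => v; rewrite !inE /contract => /and3P[-> -> ruv].
  by rewrite ruv /= andbT; apply: contraTneq ruv => ->; rewrite irr.
rewrite (cardsD1 y) [y \in _]inE; case: (boolP (r u y)) => ruy; last first.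
  rewrite andbF add0n; apply: leq_trans (leq_addr _ _); exact: subset_leq_card.
rewrite (symr y) ruy andbT; case: (boolP (r x u)) => rxu; last first.
  rewrite addn0; case: (boolP (y \in S)) => yS; last first.
    by rewrite add0n; apply: subset_leq_card.
  have xN : x \notin nbhd S r u :\ y by rewrite !inE !negb_and (symr u) rxu !orbT.
  have <- : #|x |: (nbhd S r u :\ y)| = (true + #|nbhd S r u :\ y|)%N.
    by rewrite cardsU1 xN.
  apply: subset_leq_card; rewrite finset.subUset finset.sub1set sub andbT.
  by rewrite !inE /contract eq_sym yx xS ux eqxx ruy !orbT.
by rewrite addnC leq_add ?subset_leq_card //; case: (y \in S).
Qed.

(** The contracted edge disappears, and at each common neighbour two edges merge into one; every
    lost edge counts twice in the degree sum. *)
Lemma sum_degree_contract S r x y : symmetric r -> irreflexive r ->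
  x \in S -> y \in S -> r x y ->
  (\sum_(u in S) #|nbhd S r u| <=
     \sum_(u in S :\ y) #|nbhd (S :\ y) (contract r x y) u|
     + 2 * #|nbhd S r x :&: nbhd S r y|.+1)%N.
Proof.
move=> symr irr xS yS rxy.
have yx : y != x by apply: contraTneq rxy => ->; rewrite irr.
have xSy : x \in S :\ y by rewrite !inE eq_sym yx.
set com := nbhd S r x :&: nbhd S r y.
rewrite (big_setD1 y) //= (big_setD1 x) //= [X in (_ <= X + _)%N](big_setD1 x) //=.
set B := (S :\ y) :\ x.
have h1 : (\sum_(u in B) #|nbhd S r u| <=
    \sum_(u in B) #|nbhd (S :\ y) (contract r x y) u| + #|com|)%N.
  apply: leq_trans (_ : \sum_(u in B) (#|nbhd (S :\ y) (contract r x y) u| + (r x u && r y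
    u)) <= _)%N.
    apply: leq_sum => u; rewrite !inE => /and3P[ux _ uS].
    exact: degree_contract.
  rewrite big_split leq_add2l -sum1_card big_mkcond [X in (_ <= X)%N]big_mkcond.
  apply: leq_sum => u _; rewrite !inE.
  by case: (r x u); case: (r y u); case: (u \in S); case: (u == x); case: (u == y).
have h2 : (#|nbhd S r y| + #|nbhd S r x| <=
    #|nbhd (S :\ y) (contract r x y) x| + #|com| + 2)%N.
  rewrite addnC -cardsUI -addnA [(_ + 2)%N]addnC addnA leq_add2r.
  rewrite (cardsD1 x) (cardsD1 y) addnA addnC leq_add //; last first.
    by case: (_ \in _); case: (_ \in _).
  apply: subset_leq_card; apply/fintype.subsetP => u.
  rewrite !inE /contract eqxx [x == u]eq_sym => /and3P[-> -> /orP[]/andP[-> ->]] //=.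
  by rewrite orbT.
by move: h1 h2; lia.
Qed.

(* An edge whose ends have few common neighbours can be contracted; if there is
   none, then the graph induced on a neighbourhood is dense, and it belongs to the
   minor-closed class of the graphs whose cone is in [Q]. *)
Lemma minor_closed_edges (t : nat) Q :
  subgraph_closed Q -> contract_closed Q ->
  (forall S r T, Q S r -> T \subset S -> clique T r -> #|T| != t.+2) ->
  forall S r, Q S r -> symmetric r -> irreflexive r ->
    (\sum_(x in S) #|nbhd S r x| <= 2 * (2 ^ t).-1 * #|S|)%N.
Proof.
elim: t Q => [|t IH] Q sQ cQ noK S r.
  move=> QS symr irr; rewrite big1 // => x xS; apply/eqP; rewrite cards_eq0.
  apply/negPn/negP => /finset.set0Pn[y]; rewrite inE => /andP[yS rxy].
  have sub : [set x; y]%SET \subset S by rewrite finset.subUset !finset.sub1set xS.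
  have cxy : clique [set x; y]%SET r.
    by move=> u v; rewrite !inE => /orP[]/eqP-> /orP[]/eqP->; rewrite ?eqxx // symr.
  have xy : x != y by apply: contraTneq rxy => ->; rewrite irr.
  by have := noK _ _ _ QS sub cxy; rewrite cards2 xy.
set c := ((2 ^ t.+1).-1); set c' := (2 ^ t).-1 in IH.
(* Contracting an edge with fewer than [c] common neighbours loses at most [2 * c], which the
   removed vertex pays for. Otherwise all degrees inside the neighbourhood of [x] are at least
   [2 * c' + 1], above the average [2 * c'] that the induction hypothesis allows. *)
have cE : c = (2 * c').+1 by rewrite /c /c' expnS; have := expn_gt0 2 t; lia.
move en : #|S| => n; elim: n S r en => [|n IHn] S r en QS symr irr.
  by rewrite big1 // => x; rewrite (cards0_eq en) inE.
case: (boolP [exists x in S, exists y in S, r x y && (#|nbhd S r x :&: nbhd S r y| < c)%N]).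
  case/exists_inP=> x xS /exists_inP[y yS /andP[rxy com]].
  apply: leq_trans (sum_degree_contract symr irr xS yS rxy) _.
  have en' : #|S :\ y| = n by move: en; rewrite (cardsD1 y) yS => -[].
  have /= := IHn _ (contract r x y) en' (cQ _ _ _ _ xS yS rxy QS) (contract_sym _ _ symr).
  have irr' : irreflexive (contract r x y) by move=> u; rewrite /contract eqxx.
  by move=> /(_ irr'); move: com; rewrite -/c; nia.
move=> dense.
have [/exists_inP[x xS /exists_inP[y yS rxy]]|] :=
    boolP [exists x in S, exists y in S, r x y]; last first.
  move=> noedge; rewrite big1 // => x xS; apply/eqP; rewrite cards_eq0.
  apply/negPn/negP => /finset.set0Pn[y]; rewrite inE => /andP[yS rxy].
  by case/negP: noedge; apply/exists_inP; exists x => //; apply/exists_inP; exists y.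
pose N := nbhd S r x.
have xN : x \notin N by rewrite inE irr andbF.
have NS : x |: N \subset S.
  by rewrite finset.subUset finset.sub1set xS; apply/fintype.subsetP => u; rewrite inE => /andP[].
have QN : coned Q N r.
  exists x => //; apply: sQ QS => // u v; rewrite !inE /cone.
  case/predU1P=> [->|/andP[uS rxu]] /predU1P[->|/andP[vS rxv]]; rewrite ?eqxx ?orbT //.
  - by rewrite symr.
  - by case: ifP => // /orP[]/eqP->; rewrite // symr.
have noK' S' r' T : coned Q S' r' -> T \subset S' -> clique T r' -> #|T| != t.+2.
  case=> z zS' Qz TS' cT.
  have zT : z \notin T by apply: contra zS'; apply: (fintype.subsetP TS').
  have := noK _ _ (z |: T) Qz (finset.setUS _ TS').
  rewrite cardsU1 zT add1n eqSS; apply => u v; rewrite !inE /cone.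
  case/predU1P=> [->|uT] /predU1P[->|vT]; rewrite ?eqxx ?orbT //.
  by move=> uv; case: ifP => // _; apply: cT.
have := IH _ (coned_subgraph sQ) (coned_contract sQ cQ) noK' N r QN symr irr.
have : (c * #|N| <= \sum_(u in N) #|nbhd N r u|)%N.
  rewrite mulnC -sum_nat_const; apply: leq_sum => u; rewrite inE => /andP[uS rxu].
  move/exists_inPn: dense => /(_ x xS) /exists_inPn /(_ u uS).
  rewrite rxu -leqNgt => /leq_trans; apply; apply: eq_leq; apply: eq_card => v.
  by rewrite !inE; case: (v \in S).
have : (0 < #|N|)%N by apply/card_gt0P; exists y; rewrite inE yS.
rewrite cE; nia.
Qed.

End Mader.

(** * Orientations and crossings of five points *)

Section Orientation.
Variable R : realFieldType.
Implicit Types a b c d e : R * R.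

(** Twice the signed area of the triangle. *)
Definition det3 a b c : R :=
  (b.1 - a.1) * (c.2 - a.2) - (b.2 - a.2) * (c.1 - a.1).

Definition orient a b c : bool := 0 < det3 a b c.

Definition crossing a b c d : bool :=
  (orient a b c (+) orient a b d) && (orient c d a (+) orient c d b).

Definition in_triangle a b c d : bool :=
  (orient a b d == orient b c d) && (orient b c d == orient c a d).

Lemma crossingC a b c d : crossing a b c d = crossing c d a b.
Proof. by rewrite /crossing andbC. Qed.

Lemma det3C a b c : det3 b a c = - det3 a b c.
Proof. by rewrite /det3; ring. Qed.

Lemma det3_cycle a b c : det3 b c a = det3 a b c.
Proof. by rewrite /det3; ring. Qed.

Lemma orient_cycle a b c : orient b c a = orient a b c.
Proof. by rewrite /orient det3_cycle. Qed.

Lemma orientC a b c : det3 a b c != 0 -> orient b a c = ~~ orient a b c.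
Proof. by move=> n0; rewrite /orient det3C oppr_gt0 -leNgt le_eqVlt (negPf n0). Qed.

(** Expresses the three pairings of four points by the signs of the four increasing triples, so that
    parity identities become propositional. *)
Lemma crossing_orient a b c d :
  det3 a b c != 0 -> det3 a b d != 0 -> det3 a c d != 0 -> det3 b c d != 0 ->
  [/\ crossing a b c d =
        (orient a b c (+) orient a b d) && (orient a c d (+) orient b c d),
      crossing a c b d =
        ~~ (orient a b c (+) orient a c d) && ~~ (orient a b d (+) orient b c d)
    & crossing a d b c =
        (orient a b d (+) orient a c d) && (orient a b c (+) orient b c d)].
Proof.
move=> abc abd acd bcd; rewrite /crossing.
have swap x y z : det3 x y z != 0 -> orient x z y = ~~ orient x y z.
  by move=> n0; rewrite -orient_cycle -[orient z y x]orient_cycle orientC // orient_cycle.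
have cda : orient c d a = orient a c d by rewrite orient_cycle.
have cdb : orient c d b = orient b c d by rewrite orient_cycle.
have bda : orient b d a = orient a b d by rewrite orient_cycle.
have bca : orient b c a = orient a b c by rewrite orient_cycle.
have bdc := swap _ _ _ bcd; have adb := swap _ _ _ abd.
have adc := swap _ _ _ acd; have acb := swap _ _ _ abc.
rewrite cda cdb bda bca bdc adb adc acb.
by split=> //; do 4 case: orient.
Qed.

(** Three nonzero terms with sum zero cannot share a sign. [(+)] is true when a product is negative,
    and the negation accounts for the minus sign. *)
Lemma sign_plucker (x y z u v w : R) :
  x * u - y * v + z * w = 0 ->
  x != 0 -> y != 0 -> z != 0 -> u != 0 -> v != 0 -> w != 0 ->
  ~~ (((0 < x) (+) (0 < u) == ~~ ((0 < y) (+) (0 < v)))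
   && ((0 < x) (+) (0 < u) == (0 < z) (+) (0 < w))).
Proof.
move=> eq0.
case: (ltrgtP x) => //= hx _; case: (ltrgtP y) => //= hy _; case: (ltrgtP z) => //= hz _;
case: (ltrgtP u) => //= hu _; case: (ltrgtP v) => //= hv _; case: (ltrgtP w) => //= hw _; nra.
Qed.

(** The three-term Grassmann-Plucker relations, one for each choice of the point common to all
    factors. *)
Lemma orient_plucker a b c d e :
  det3 a b c != 0 -> det3 a b d != 0 -> det3 a b e != 0 -> det3 a c d != 0 -> det3 a c e
    != 0 -> det3 a d e != 0 -> det3 b c d != 0 -> det3 b c e != 0 -> det3 b d e != 0 ->
    det3 c d e != 0 ->
  let pl x y z u v w := ~~ ((x (+) u == ~~ (y (+) v)) && (x (+) u == z (+) w)) in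
  [/\ pl (orient a b c) (orient a b d) (orient a b e) (orient a d e) (orient a c e) (orient a c d),
      pl (orient a b c) (orient a b d) (orient a b e) (orient b d e) (orient b c e) (orient b c d),
      pl (orient a b c) (orient a c d) (orient a c e) (orient c d e) (orient b c e) (orient b c d),
      pl (orient a b d) (orient a c d) (orient a d e) (orient c d e) (orient b d e) (orient b c d)
    & pl (orient a b e) (orient a c e) (orient a d e) (orient c d e) (orient b d e) (orient b c e)].
Proof.
move=> habc habd habe hacd hace hade hbcd hbce hbde hcde pl.
by split; apply: sign_plucker => //; rewrite /det3; ring.
Qed.

(** The segment [de] crosses the boundary of the triangle [abc] an odd number of times exactly when
    one of its ends is inside. The proof checks the sign patterns that the Plucker relations
    permit. *)
Lemma crossing_triangle a b c d e :
  det3 a b c != 0 -> det3 a b d != 0 -> det3 a b e != 0 -> det3 a c d != 0 -> det3 a c e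
    != 0 -> det3 a d e != 0 -> det3 b c d != 0 -> det3 b c e != 0 -> det3 b d e != 0 ->
    det3 c d e != 0 ->
  crossing a b d e (+) crossing b c d e (+) crossing a c d e =
    in_triangle a b c d (+) in_triangle a b c e.
Proof.
move=> habc habd habe hacd hace hade hbcd hbce hbde hcde.
have [] := orient_plucker habc habd habe hacd hace hade hbcd hbce hbde hcde.
have [-> _ _] := crossing_orient habd habe hade hbde.
have [-> _ _] := crossing_orient hbcd hbce hbde hcde.
have [-> _ _] := crossing_orient hacd hace hade hcde.
rewrite /in_triangle (orientC hacd) (orientC hace).
case: (orient a b c) => //=; case: (orient a b d) => //=; case: (orient a b e) => //=;
  case: (orient a c d) => //=; case: (orient a c e) => //=; case: (orient a d e) => //=;
  case: (orient b c d) => //=; case: (orient b c e) => //=; case: (orient b d e) => //=;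
  case: (orient c d e) => //=.
Qed.

(** The fifteen terms are the pairs of disjoint edges of a straight-line K5. Of the [2 ^ 10] sign
    patterns, all that obey the Plucker relations give odd parity. *)
Lemma crossing_K5 a b c d e :
  det3 a b c != 0 -> det3 a b d != 0 -> det3 a b e != 0 -> det3 a c d != 0 -> det3 a c e
    != 0 -> det3 a d e != 0 -> det3 b c d != 0 -> det3 b c e != 0 -> det3 b d e != 0 ->
    det3 c d e != 0 ->
  crossing a b c d (+)
  crossing a b c e (+)
  crossing a b d e (+)
  crossing a c b d (+)
  crossing a c b e (+)
  crossing a c d e (+)
  crossing a d b c (+)
  crossing a d b e (+)
  crossing a d c e (+)
  crossing a e b c (+)
  crossing a e b d (+)
  crossing a e c d (+)
  crossing b c d e (+)
  crossing b d c e (+)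
  crossing b e c d.
Proof.
move=> habc habd habe hacd hace hade hbcd hbce hbde hcde.
have [] := orient_plucker habc habd habe hacd hace hade hbcd hbce hbde hcde.
have [-> -> ->] := crossing_orient habc habd hacd hbcd.
have [-> -> ->] := crossing_orient habc habe hace hbce.
have [-> -> ->] := crossing_orient habd habe hade hbde.
have [-> -> ->] := crossing_orient hacd hace hade hcde.
have [-> -> ->] := crossing_orient hbcd hbce hbde hcde.
move=> p1 p2 p3 p4 p5; move: (introT and5P (And5 p1 p2 p3 p4 p5)) => {p1 p2 p3 p4 p5}; apply/implyP.
move: (orient a b c) (orient a b d) (orient a b e) (orient a c d) (orient a c e) (orient a
  d e) (orient b c d) (orient b c e) (orient b d e) (orient c d e).
by do 10 case.
Qed.

End Orientation.

(** * Perturbation into general position *)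

Section Perturbation.
Variable R : realFieldType.

Definition general_position (n : nat) (q : nat -> R * R) :=
  forall i j k, (i < n)%N -> (j < n)%N -> (k < n)%N ->
  uniq [:: i; j; k] -> det3 (q i) (q j) (q k) != 0.

(** The values [eta / k.+1] for [k < size P] are distinct, and there is one more of them than the
    degree of [P]. *)
Lemma poly_nonroot (P : {poly R}) (eta : R) : P != 0 -> 0 < eta ->
  exists2 t, 0 < t <= eta & P.[t] != 0.
Proof.
move=> P0 eta0; pose f k : R := eta / k.+1%:R.
pose s := [seq f k | k <- iota 0 (size P)].
have us : uniq s.
  rewrite map_inj_uniq ?iota_uniq // => i j /(mulfI (lt0r_neq0 eta0)) /invr_inj /eqP.
  by rewrite eqr_nat => /eqP[].
have : ~~ all (root P) s.
  by apply/negP => /(max_poly_roots P0) /(_ us); rewrite size_map size_iota ltnn.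
case/allPn => _ /mapP[k _ ->] nr; exists (f k) => //.
by rewrite divr_gt0 //= ler_pdivrMr // ler_peMr ?(ltW eta0) // ler1n.
Qed.

(* Moving the points along the moment curve: the determinant of three moved
   points is quadratic in [t], with a Vandermonde leading coefficient. *)
Lemma perturb_general_position (n : nat) (p : nat -> R * R) (eta : R) : 0 < eta ->
  exists2 q, general_position n q &
    forall i, (i < n)%N ->
      `|(q i).1 - (p i).1| <= eta /\ `|(q i).2 - (p i).2| <= eta.
Proof.
move=> eta0.
pose q t i : R * R := ((p i).1 + t * i%:R, (p i).2 + t * i%:R ^+ 2).
pose V i j k : R := (j%:R - i%:R) * (k%:R - i%:R) * (k%:R - j%:R).
pose D i j k : R := ((p j).1 - (p i).1) * (k%:R ^+ 2 - i%:R ^+ 2)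
  + (j%:R - i%:R) * ((p k).2 - (p i).2)
  - ((p j).2 - (p i).2) * (k%:R - i%:R)
  - (j%:R ^+ 2 - i%:R ^+ 2) * ((p k).1 - (p i).1).
pose P i j k : {poly R} :=
  (det3 (p i) (p j) (p k))%:P + (D i j k)%:P * 'X + (V i j k)%:P * 'X^2.
have PE i j k t : (P i j k).[t] = det3 (q t i) (q t j) (q t k).
  by rewrite /P !hornerE /det3 /D /V /q /=; ring.
have P0 i j k : uniq [:: i; j; k] -> P i j k != 0.
  rewrite /= !inE negb_or andbT => /andP[/andP[ij ik] jk].
  apply/eqP => /polyP /(_ 2%N).
  rewrite /P !coefD coefC coefMX coefC coefCM coefXn coef0 /= add0r mulr1 add0r => /eqP.
  rewrite /V !mulf_eq0 !subr_eq0 !eqr_nat.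
  by rewrite (eq_sym j) (negPf ij) (eq_sym k i) (negPf ik) (eq_sym k) (negPf jk).
(* A nonroot of the product serves all triples at once. It is sought below [eta / n.+1 ^ 2] since
   the coordinates of point [i] move by [t * i] and [t * i ^ 2]. *)
pose PP := \prod_(x : 'I_n * 'I_n * 'I_n | uniq [:: x.1.1 : nat; x.1.2 : nat; x.2 : nat])
  P x.1.1 x.1.2 x.2.
have PP0 : PP != 0 by apply/prodf_neq0 => x; apply: P0.
have e0 : 0 < eta / (n.+1)%:R ^+ 2 by rewrite divr_gt0 ?exprn_gt0 ?ltr0n.
have [t /andP[t0 te] PPt] := poly_nonroot PP0 e0.
exists (q t) => [i j k ilt jlt klt u|i ilt].
  move: PPt; rewrite horner_prod => /prodf_neq0.
  by move=> /(_ (Ordinal ilt, Ordinal jlt, Ordinal klt)) /= /(_ u); rewrite PE.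
have iR : (i%:R : R) <= n.+1%:R by rewrite ler_nat ltnW // ltnW.
have n1 : (1 : R) <= n.+1%:R by rewrite ler1n.
have i0 : (0 : R) <= i%:R by rewrite ler0n.
have tn : t * n.+1%:R ^+ 2 <= eta by rewrite -ler_pdivlMr // exprn_gt0 ?ltr0n.
rewrite /q /= !(addrC (p i).1, addrC (p i).2) !addrK.
rewrite !ger0_norm ?mulr_ge0 ?exprn_ge0 ?(ltW t0) //.
by split; apply: le_trans tn; rewrite ler_wpM2l ?(ltW t0) //; nra.
Qed.

End Perturbation.

(** * Parity of crossings between chains joining five points *)

Section CrossingParity.
Variables (R : realFieldType) (n : nat) (q : nat -> R * R).
Hypothesis q_gen : general_position n q.
Implicit Types (a b c d i j : nat) (s t : seq nat).

Local Notation cr a b c d := (crossing (q a) (q b) (q c) (q d)).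
Local Notation inT a b c d := (in_triangle (q a) (q b) (q c) (q d)).

Lemma general_position5 (Q : Prop) a b c d e :
  all (gtn n) [:: a; b; c; d; e] -> uniq [:: a; b; c; d; e] ->
  (det3 (q a) (q b) (q c) != 0 -> det3 (q a) (q b) (q d) != 0 -> det3 (q a) (q b) (q e) !=
    0 -> det3 (q a) (q c) (q d) != 0 -> det3 (q a) (q c) (q e) != 0 -> det3 (q a) (q d) (q
    e) != 0 -> det3 (q b) (q c) (q d) != 0 -> det3 (q b) (q c) (q e) != 0 -> det3 (q b) (q
    d) (q e) != 0 -> det3 (q c) (q d) (q e) != 0 -> Q) -> Q.
Proof.
rewrite /= !inE !negb_or -!andbA.
case/and5P=> la lb lc ld /andP[le _].
case/and5P=> ab ac ad ae /and5P[bc bd be cd /and3P[ce de _]].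
by apply; apply: q_gen; rewrite //= !inE !negb_or; do !(apply/andP; split).
Qed.

Lemma triangle_crossings a b c d e :
  all (gtn n) [:: a; b; c; d; e] -> uniq [:: a; b; c; d; e] ->
  cr a b d e (+) cr b c d e (+) cr a c d e = inT a b c d (+) inT a b c e.
Proof. by move=> lt u; apply: (general_position5 lt u); apply: crossing_triangle. Qed.

Lemma K5_crossings : (4 < n)%N ->
  cr 0 1 2 3 (+)
  cr 0 1 2 4 (+)
  cr 0 1 3 4 (+)
  cr 0 2 1 3 (+)
  cr 0 2 1 4 (+)
  cr 0 2 3 4 (+)
  cr 0 3 1 2 (+)
  cr 0 3 1 4 (+)
  cr 0 3 2 4 (+)
  cr 0 4 1 2 (+)
  cr 0 4 1 3 (+)
  cr 0 4 2 3 (+)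
  cr 1 2 3 4 (+)
  cr 1 3 2 4 (+)
  cr 1 4 2 3.
Proof.
move=> n5; have lt : all (gtn n) [:: 0; 1; 2; 3; 4]%N by rewrite /=; lia.
by apply: (general_position5 lt) => //; apply: crossing_K5.
Qed.

Fixpoint path_crossings c d a s : bool :=
  if s is b :: s' then cr a b c d (+) path_crossings c d b s' else false.

Fixpoint paths_crossings a s c t : bool :=
  if t is d :: t' then path_crossings c d a s (+) paths_crossings a s d t'
  else false.

Fixpoint in_fan a b s x : bool :=
  if s is b' :: s' then inT a b b' x (+) in_fan a b' s' x else false.

(* The mod 2 winding number around [x] of the path [a :: s] closed up by the
   segment from its end to [a]. *)
Definition in_loop a s x : bool := if s is b :: s' then in_fan a b s' x else false.

(** The path and its chord form a loop, which the segment [cd] crosses an odd number of times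
    exactly when the loop separates [c] from [d]. The induction cuts off one triangle of the fan at
    [a] at a time. *)
Lemma path_crossings_segment c d a s :
  s != [::] -> all (gtn n) (c :: d :: a :: s) -> uniq (c :: d :: a :: s) ->
  path_crossings c d a s =
    cr a (last a s) c d (+) in_loop a s c (+) in_loop a s d.
Proof.
case: s => // b s _; elim: s b => [|b' s IH] b lt u.
  by rewrite /= !addbF.
have lt' : all (gtn n) [:: c, d, a, b' & s].
  by move: lt => /= /and5P[-> -> -> _ /andP[-> ->]].
have u' : uniq [:: c, d, a, b' & s].
  move: u; rewrite /= !inE !negb_or -!andbA.
  by do !case/andP=> ?; move=> ?; do !(apply/andP; split).
have {IH} := IH b' lt' u'.
have := @triangle_crossings a b b' c d.
rewrite /= !inE !negb_or; move: lt u; rewrite /= !inE !negb_or -!andbA.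
case/and5P=> -> -> -> -> /andP[-> _].
case/and5P=> -> ca cb cb' /and5P[_ da db db' /and5P[_ -> -> _ /andP[-> _]]].
rewrite ![_ == c]eq_sym ![_ == d]eq_sym ca cb cb' da db db' => /(_ isT isT) /=.
move=> tri IH; have -> : path_crossings c d b' s = cr a b' c d (+)
    (cr a (last b' s) c d (+) in_fan a b' s c (+) in_fan a b' s d).
  by rewrite -IH addKb.
have -> : cr a b' c d = cr a b c d (+) cr b b' c d (+) (inT a b b' c (+) inT a b b' d).
  by rewrite -tri addKb.
move: (cr a b c d) (cr b b' c d) (inT a b b' c) (inT a b b' d) (cr a (last b' s) c d)
  (in_fan a b' s c) (in_fan a b' s d).
by do 7 case.
Qed.

(** The first path is straightened against each segment of the second, where the loop parities
    telescope; then the second is straightened against the chord of the first. *)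
Lemma paths_crossings_segments a s c t :
  s != [::] -> t != [::] -> all (gtn n) (a :: s ++ c :: t) -> uniq (a :: s ++ c :: t) ->
  paths_crossings a s c t =
    cr a (last a s) c (last c t)
      (+) (in_loop a s c (+) in_loop a s (last c t))
      (+) (in_loop c t a (+) in_loop c t (last a s)).
Proof.
move=> s0 t0 lt u.
have lts : all (gtn n) (a :: s) by move: lt; rewrite -cat_cons all_cat => /andP[].
have ltt : all (gtn n) (c :: t) by move: lt; rewrite -cat_cons all_cat => /andP[].
move: u; rewrite -cat_cons cat_uniq => /and3P[us st ut].
have telescope : paths_crossings a s c t =
    path_crossings a (last a s) c t (+) (in_loop a s c (+) in_loop a s (last c t)).
  elim: t c {t0 lt} ltt st ut => [|d t IH] c /=; first by rewrite addbb.
  move=> /and3P[lc ld ltt] /norP[cs /norP[ds st]] /and3P[ct dt ut].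
  have -> : path_crossings c d a s =
      cr a (last a s) c d (+) in_loop a s c (+) in_loop a s d.
    apply: path_crossings_segment => //; first by rewrite /= lc ld.
    move: ct cs ds us; rewrite /= !in_cons !negb_or.
    by move=> /andP[-> _] /andP[-> ->] /andP[-> ->] /andP[-> ->].
  have -> := IH d; rewrite /= ?ld ?dt //; last by apply/norP; split.
  rewrite crossingC.
  set x := crossing _ _ _ _; set y := path_crossings _ _ _ _.
  move: (in_loop a s c) (in_loop a s d) (in_loop a s (last d t)) x y.
  by do 5 case.
have lastP : last a s \in s by case: (s) s0 => //= b s' _; apply: mem_last.
rewrite telescope path_crossings_segment //.
- rewrite crossingC.
  set x := cr _ _ _ _; move: (in_loop c t a) (in_loop c t (last a s)) (in_loop a s c)
    (in_loop a s (last c t)) x.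
  by do 5 case.
- move: lts => /= /andP[-> /allP lts]; move: ltt => /= /andP[-> ->].
  by have /= -> := lts _ lastP.
- rewrite cons_uniq in_cons negb_or cons_uniq ut andbT -!andbA.
  move/hasPn: st => st; apply/and3P; split.
  + by move: us => /= /andP[+ _]; apply: contraNneq => {1}->.
  + by apply/negP => /st /=; rewrite mem_head.
  + by apply/negP => /st /=; rewrite in_cons lastP orbT.
Qed.

End CrossingParity.

(** * Crossings of short segments *)

Section CloseChains.
Variable R : realFieldType.
Implicit Types (a b c d : R * R) (r eps : R).

Definition close r a b := (`|a.1 - b.1| <= r) && (`|a.2 - b.2| <= r).

Lemma close_trans r r' a b c : close r a b -> close r' b c -> close (r + r') a c.
Proof.
move=> /andP[h1 h2] /andP[h3 h4]; apply/andP; split.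
  by rewrite (le_trans (ler_distD b.1 _ _)) // lerD.
by rewrite (le_trans (ler_distD b.2 _ _)) // lerD.
Qed.

Lemma closeC r a b : close r a b = close r b a.
Proof. by rewrite /close distrC [in X in _ && X]distrC. Qed.

(** The determinant against one segment is affine along the other and changes sign there; its zeros
    are [u = z / (z - w)] and [v = x / (x - y)]. *)
Lemma crossing_meet a b c d : crossing a b c d ->
  exists u v, [/\ 0 <= u <= 1, 0 <= v <= 1,
    a.1 + u * (b.1 - a.1) = c.1 + v * (d.1 - c.1) &
    a.2 + u * (b.2 - a.2) = c.2 + v * (d.2 - c.2)].
Proof.
rewrite /crossing /orient => /andP[hab hcd].
set x := det3 a b c in hab; set y := det3 a b d in hab.
set z := det3 c d a in hcd; set w := det3 c d b in hcd.
have xy : x - y = w - z by rewrite /x /y /z /w /det3; ring.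
have bound (s t : R) : (0 < s) (+) (0 < t) -> s - t != 0 /\ 0 <= s / (s - t) <= 1.
  case: (ltrP 0 s) => hs; case: (ltrP 0 t) => //= ht _.
    have st : 0 < s - t by lra.
    split; first by rewrite gt_eqF.
    apply/andP; split; first by apply: divr_ge0; lra.
    by rewrite ler_pdivrMr // mul1r; lra.
  have st : 0 < t - s by lra.
  split; first by rewrite lt_eqF //; lra.
  rewrite -opprB invrN mulrN -mulNr.
  apply/andP; split; first by apply: divr_ge0; lra.
  by rewrite ler_pdivrMr // mul1r; lra.
have [nxy bxy] := bound _ _ hab; have [nzw bzw] := bound _ _ hcd.
exists (z / (z - w)), (x / (x - y)); split=> //;
  rewrite -[x - y]opprB -[y - x]opprB xy opprK -[w - z]opprB invrN mulrN.
- have e : a.1 * (z - w) + z * (b.1 - a.1) = c.1 * (z - w) - x * (d.1 - c.1).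
    by rewrite /x /z /w /det3; ring.
  apply: (mulIf nzw); transitivity (a.1 * (z - w) + z * (b.1 - a.1)); first by field.
  by rewrite e; field.
- have e : a.2 * (z - w) + z * (b.2 - a.2) = c.2 * (z - w) - x * (d.2 - c.2).
    by rewrite /x /z /w /det3; ring.
  apply: (mulIf nzw); transitivity (a.2 * (z - w) + z * (b.2 - a.2)); first by field.
  by rewrite e; field.
Qed.

Lemma crossing_close r a b c d :
  crossing a b c d -> close r a b -> close r c d -> close (r + r) a c.
Proof.
case/crossing_meet => u [v] [/andP[u0 u1] /andP[v0 v1] e1 e2].
have bound (x y z t : R) : x + u * (y - x) = z + v * (t - z) ->
    `|x - y| <= r -> `|z - t| <= r -> `|x - z| <= r + r.
  move=> e xy zt; have -> : x - z = u * (x - y) - v * (z - t) by lra.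
  rewrite (le_trans (ler_normB _ _)) // lerD // normrM ger0_norm //.
    by apply: le_trans xy; rewrite ler_piMl.
  by apply: le_trans zt; rewrite ler_piMl.
by move=> /andP[ab1 ab2] /andP[cd1 cd2]; apply/andP; split; [apply: bound e1 _ _|apply:
  bound e2 _ _].
Qed.

Lemma no_paths_crossing (q : nat -> R * R) (e : rel nat) (a c : nat) (s t : seq nat) :
  path e a s -> path e c t ->
  (forall x x' y y', x \in a :: s -> x' \in a :: s -> y \in c :: t ->
     y' \in c :: t -> e x x' -> e y y' -> crossing (q x) (q x') (q y) (q y') = false) ->
  paths_crossings q a s c t = false.
Proof.
move=> pa pc no; elim: t c pc no => //= d t IH c /andP[cd pt] no.
rewrite {}IH // => [|x x' y y' xs xs' yt yt']; last first.
  by apply: no; rewrite // in_cons ?yt ?yt' orbT.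
rewrite addbF; elim: s a pa no => //= b s IH a /andP[ab ps] no.
rewrite {}IH // => [|x x' y y' xs xs' yt yt']; last first.
  by apply: no; rewrite // in_cons ?xs ?xs' orbT.
by rewrite no // !inE eqxx ?orbT.
Qed.

End CloseChains.

(** * The van Kampen obstruction for chains *)

Section K5.
Variable R : realFieldType.
Variables (eps : R) (v : nat -> R * R) (l : nat -> nat -> seq (R * R)).

(** Numbers below 5 stand for the vertices, [code i j k] for entry [k] of the chain from [i] to [j].
    Indexing places instead of points keeps indices distinct where points coincide, as the parity
    lemmas require; [pt] decodes. *)
Let code i j k := (5 + (k * 25 + (i * 5 + j)))%N.
Let inner i j := [seq code i j k | k <- iota 0 (size (l i j))].
Let idx i j := rcons (inner i j) j.
Let pt m : R * R := if (m < 5)%N then v m else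
  let c := ((m - 5) %% 25)%N in nth (v 0%N) (l (c %/ 5) (c %% 5)) ((m - 5) %/ 25).

Let ptE i j : (i < 5)%N -> (j < 5)%N -> map pt (idx i j) = rcons (l i j) (v j).
Proof.
move=> i5 j5; rewrite map_rcons {2}/pt j5; congr rcons.
rewrite -map_comp -[RHS](mkseq_nth (v 0%N)); apply: eq_map => k /=.
have c25 : (i * 5 + j < 25)%N by lia.
rewrite /pt /code ltnNge leq_addr /= addnC addnK modnMDl modn_small //.
by rewrite !divnMDl // modnMDl modn_small // !divn_small // !addn0.
Qed.

Let idx_uniq i j k m : (i < 5)%N -> (j < 5)%N -> (k < 5)%N -> (m < 5)%N ->
  uniq [:: i; j; k; m] -> uniq (i :: idx i j ++ k :: idx k m).
Proof.
move=> i5 j5 k5 m5; rewrite /= !inE !negb_or -!andbA => /and5P[ij ik im jk /and3P[jm km _]].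
have inner_ge a b x : x \in inner a b -> (4 < x)%N by case/mapP => y _ ->; rewrite /code; lia.
have notin a b x : (x < 5)%N -> x \notin inner a b.
  by move=> x5; apply/negP => /inner_ge; rewrite ltnNge -ltnS x5.
have inner_uniq a b : uniq (inner a b).
  by rewrite map_inj_uniq ?iota_uniq // => x y; rewrite /code; lia.
have disj : ~~ has (mem (inner i j)) (inner k m).
  apply/hasPn => x /mapP[y _ ->]; apply/negP => /mapP[y' _].
  by rewrite /code; lia.
rewrite /idx mem_cat in_cons !mem_rcons !in_cons !negb_or ij ik im !notin //=.
rewrite cat_uniq /= !rcons_uniq !inner_uniq !mem_rcons !in_cons !negb_or !notin //.
rewrite has_rcons !mem_rcons !in_cons !negb_or !notin // (eq_sym k j) jk (eq_sym m j) jm km.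
rewrite !andbT /=; apply/hasPn => x xkm; rewrite /= mem_rcons in_cons negb_or.
apply/andP; split; first by apply: contraTneq xkm => ->; apply: notin.
by move/hasPn: disj; apply.
Qed.

Theorem K5_chains : 0 < eps ->
  (forall i j, (i < j < 5)%N -> path (close eps) (v i) (rcons (l i j) (v j))) ->
  exists i j k m, [/\ (i < j < 5)%N, (k < m < 5)%N, uniq [:: i; j; k; m] &
    exists a b, [/\ a \in v i :: rcons (l i j) (v j),
      b \in v k :: rcons (l k m) (v m) & close (8 * eps) a b]].
Proof.
move=> eps0 chain; apply: contrapT => noclose.
pose L := \max_(x : 'I_5 * 'I_5) size (l x.1 x.2).
pose n := code 5 5 L.
have idx_lt i j : (i < 5)%N -> (j < 5)%N -> all (gtn n) (i :: idx i j).
  move=> i5 j5; rewrite /= all_rcons /=.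
  have -> : (i < n)%N by rewrite /n /code; lia.
  have -> : (j < n)%N by rewrite /n /code; lia.
  apply/allP => _ /mapP[k kl ->] /=; move: kl; rewrite mem_iota add0n => /andP[_ kl].
  have : (size (l i j) <= L)%N.
    exact: (leq_bigmax (F := fun x : 'I_5 * 'I_5 => size (l x.1 x.2)) (Ordinal i5, Ordinal j5)).
  by rewrite /n /code; lia.
have [q gq closeq] := perturb_general_position n pt eps0.
have nocross i j k m : (i < j < 5)%N -> (k < m < 5)%N -> uniq [:: i; j; k; m] ->
    paths_crossings q i (idx i j) k (idx k m) = false.
  move=> ij km u.
  have [i5 j5 k5 m5] : [/\ i < 5, j < 5, k < 5 & m < 5]%N by split; lia.
  have pidx a b : (a < b < 5)%N -> path (relpre pt (close eps)) a (idx a b).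
    move=> ab; have [a5 b5] : (a < 5 /\ b < 5)%N by lia.
    by rewrite -path_map ptE // {1}/pt a5; apply: chain.
  have mem a b x : (a < 5)%N -> (b < 5)%N -> x \in a :: idx a b ->
      pt x \in v a :: rcons (l a b) (v b).
    move=> a5 b5 /(map_f pt); rewrite [map _ _]/= ptE //.
    by have -> : pt a = v a by rewrite /pt a5.
  have qpt a b x : (a < 5)%N -> (b < 5)%N -> x \in a :: idx a b -> close eps (q x) (pt x).
    by move=> a5 b5 /(allP (idx_lt _ _ a5 b5)) /closeq [? ?]; apply/andP.
  apply: no_paths_crossing (pidx _ _ ij) (pidx _ _ km) _ => x x' y y' xs xs' yt yt' xx yy.
  apply/negP => cross; apply: noclose; exists i, j, k, m; split=> //.
  exists (pt x), (pt y); split; rewrite ?mem //.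
  have three a b z z' : (a < 5)%N -> (b < 5)%N -> z \in a :: idx a b -> z' \in a :: idx a b ->
      close eps (pt z) (pt z') -> close (eps + eps + eps) (q z) (q z').
    move=> a5 b5 zs zs' zz; apply: close_trans (close_trans (qpt _ _ _ a5 b5 zs) zz) _.
    by rewrite closeC (qpt _ _ _ a5 b5 zs').
  have six := crossing_close cross (three _ _ _ _ i5 j5 xs xs' xx) (three _ _ _ _ k5 m5 yt yt' yy).
  (* Perturbed steps have length at most [3 * eps], so crossing ones start within [6 * eps] of each
     other; undoing the perturbation adds [eps] at either end. *)
  have -> : 8 * eps = eps + (eps + eps + eps + (eps + eps + eps)) + eps by ring.
  apply: close_trans (qpt _ _ _ k5 m5 yt).
  by apply: close_trans six; rewrite closeC (qpt _ _ _ i5 j5 xs).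
pose H i j x := in_loop q i (idx i j) x.
have eqn i j k m : (i < j < 5)%N -> (k < m < 5)%N -> uniq [:: i; j; k; m] ->
    crossing (q i) (q j) (q k) (q m) = (H i j k + H i j m) + (H k m i + H k m j).
  move=> ij km u; have [i5 j5 k5 m5] : [/\ i < 5, j < 5, k < 5 & m < 5]%N by split; lia.
  have := @paths_crossings_segments _ _ _ gq i (idx i j) k (idx k m).
  rewrite nocross // -cat_cons all_cat !idx_lt // idx_uniq // /idx !last_rcons -/(idx _ _)
    -/(idx _ _).
  rewrite -!size_eq0 !size_rcons /= => /(_ isT isT isT isT).
  rewrite /H; move: (crossing _ _ _ _); do 4 move: (in_loop _ _ _ _).
  by do 5 case.
have : (4 < n)%N by rewrite /n /code; lia.
move/(K5_crossings gq).
(* The chains do not cross, so each segment crossing is a sum of four loop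
   parities; over all independent pairs every loop parity occurs twice. *)
rewrite !(eqn 0 1 2 3, eqn 0 1 2 4, eqn 0 1 3 4, eqn 0 2 1 3, eqn 0 2 1 4, eqn 0 2 3 4,
  eqn 0 3 1 2, eqn 0 3 1 4, eqn 0 3 2 4, eqn 0 4 1 2, eqn 0 4 1 3, eqn 0 4 2 3, eqn 1 2 3
  4, eqn 1 3 2 4, eqn 1 4 2 3) //.
set S := (X in is_true X).
have -> : S = 2 * (H 0 1 2 + H 0 1 3 + H 0 1 4 + H 0 2 1 + H 0 2 3 + H 0 2 4 + H 0 3 1 + H
  0 3 2 + H 0 3 4 + H 0 4 1 + H 0 4 2 + H 0 4 3 + H 1 2 0 + H 1 2 3 + H 1 2 4 + H 1 3 0 +
  H 1 3 2 + H 1 3 4 + H 1 4 0 + H 1 4 2 + H 1 4 3 + H 2 3 0 + H 2 3 1 + H 2 3 4 + H 2 4 0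
  + H 2 4 1 + H 2 4 3 + H 3 4 0 + H 3 4 1 + H 3 4 2) by rewrite /S (_ : addb = +%R) //;
  ring.
by rewrite mul0r.
Qed.

End K5.

(** * Graphs drawn by chains of points *)

Section DrawnGraph.
Variables (R : realFieldType) (V E : finType) (s t : E -> V).
Variables (eps : R) (pos : V -> R * R) (inner : E -> seq (R * R)).
Variable F : {set E}.

Definition chain_points e := pos (s e) :: rcons (inner e) (pos (t e)).

Hypothesis eps0 : 0 < eps.
Hypothesis noloop : {in F, forall e, s e != t e}.
Hypothesis chainF : {in F, forall e,
  path (close eps) (pos (s e)) (rcons (inner e) (pos (t e)))}.

Definition adj : rel V := fun x y =>
  [exists e in F, ((s e == x) && (t e == y)) || ((s e == y) && (t e == x))].

Lemma adj_sym : symmetric adj.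
Proof.
by move=> x y; apply/exists_inP/exists_inP => -[e eF h]; exists e; rewrite // orbC.
Qed.

Lemma adj_irr : irreflexive adj.
Proof.
move=> x; apply/exists_inP => -[e eF]; rewrite orbb => /andP[/eqP sx /eqP tx].
by have := noloop eF; rewrite sx tx eqxx.
Qed.

Definition adj_in (W : {set V}) : rel V := fun x y => [&& x \in W, y \in W & adj x y].

Lemma adj_in_sym W : symmetric (adj_in W).
Proof. by move=> x y; rewrite /adj_in adj_sym andbCA. Qed.

Lemma connect_adj_in (W W' : {set V}) x y : W \subset W' ->
  connect (adj_in W) x y -> connect (adj_in W') x y.
Proof.
move=> sub; apply: connect_sub => a b /and3P[aW bW ab]; apply: connect1.
by rewrite /adj_in !(fintype.subsetP sub).
Qed.

(* [B] is a system of branch sets exhibiting the graph [(S, r)] as a minor. *)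
Definition minor_model (S : {set V}) (r : rel V) := exists B : V -> {set V},
  [/\ {in S &, forall u v, u != v -> [disjoint B u & B v]},
      {in S, forall u, {in B u &, forall x y, connect (adj_in (B u)) x y}} &
      {in S &, forall u v, r u v -> exists x y, [/\ x \in B u, y \in B v & adj x y]}].

Lemma minor_model_subgraph : subgraph_closed minor_model.
Proof.
move=> S S' r r' /fintype.subsetP sub rr' [B [dis con edg]]; exists B; split.
- by move=> u v uS vS; apply: dis; apply: sub.
- by move=> u uS; apply: con; apply: sub.
- by move=> u v uS vS /(rr' _ _ uS vS); apply: edg; apply: sub.
Qed.

(** The merged vertex gets the union of two branch sets, connected through the edge that realizes
    [r x y]. *)
Lemma minor_model_contract : contract_closed minor_model.
Proof.
move=> S r x y xS yS rxy [B [dis con edg]].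
pose B' u := if u == x then B x :|: B y else B u.
have inS u : u \in S :\ y -> u \in S /\ u != y by rewrite !inE => /andP[].
exists B'; split.
- move=> u v /inS[uS uy] /inS[vS vy] uv; rewrite /B'.
  case: eqP => [ux|_]; case: eqP => [vx|_]; last exact: dis.
  + by move: uv; rewrite ux vx eqxx.
  + rewrite -setI_eq0 finset.setIUl finset.setU_eq0 !setI_eq0.
    by rewrite -{1}ux !dis // eq_sym.
  + rewrite -setI_eq0 finset.setIUr finset.setU_eq0 !setI_eq0.
    by rewrite -{1}vx !dis.
- move=> u /inS[uS uy]; rewrite /B'; case: eqP => [_|_]; last exact: con.
  have [a [b [aB bB ab]]] := edg _ _ xS yS rxy.
  have conL z w : z \in B x -> w \in B x -> connect (adj_in (B x :|: B y)) z w.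
    by move=> zB wB; apply: connect_adj_in (finset.subsetUl _ _) (con _ xS _ _ zB wB).
  have conR z w : z \in B y -> w \in B y -> connect (adj_in (B x :|: B y)) z w.
    by move=> zB wB; apply: connect_adj_in (finset.subsetUr _ _) (con _ yS _ _ zB wB).
  have cab : connect (adj_in (B x :|: B y)) a b.
    by apply: connect1; rewrite /adj_in !inE aB bB orbT.
  have conLR z w : z \in B x -> w \in B y -> connect (adj_in (B x :|: B y)) z w.
    by move=> zB wB; apply: connect_trans (conL _ _ zB aB) (connect_trans cab (conR _ _ bB wB)).
  move=> z w; rewrite !inE => /orP[zB|zB] /orP[wB|wB];
    [exact: conL|exact: conLR| |exact: conR].
  by rewrite (sym_connect_sym (adj_in_sym (B x :|: B y))) conLR.
- move=> u v /inS[uS uy] /inS[vS vy] /andP[uv].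
  have BB' w z : z \in B w -> z \in B' w.
    by rewrite /B'; case: eqP => // ->; rewrite inE => ->.
  have BB'y z : z \in B y -> z \in B' x by rewrite /B' eqxx inE orbC => ->.
  case/or3P => [ruv|/andP[/eqP ux ryv]|/andP[/eqP vx ruy]].
  + by have [a [b [aB bB ab]]] := edg _ _ uS vS ruv; exists a, b; split=> //; apply: BB'.
  + have [a [b [aB bB ab]]] := edg _ _ yS vS ryv.
    by exists a, b; split; rewrite ?ux ?BB'y ?BB'.
  + have [a [b [aB bB ab]]] := edg _ _ uS yS ruy.
    by exists a, b; split; rewrite ?vx ?BB'y ?BB'.
Qed.

Lemma minor_model_id S : minor_model S adj.
Proof.
exists (fun u => [set u]%SET); split=> [u v _ _ uv|u _ x y|u v _ _ uv].
- by rewrite -setI_eq0; apply/eqP/setP => x; rewrite !inE; apply/andP => -[/eqP-> ]; apply/negP.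
- by rewrite !inE => /eqP-> /eqP->; apply: connect0.
- by exists u, v; rewrite !inE.
Qed.

(* The chain stays in the arcs of edges of [F] that have both ends in [U]. *)
Definition chain_in (U : {set V}) (a b : R * R) := exists l,
  [/\ path (close eps) a l, last a l = b &
      forall x, x \in a :: l -> exists2 e, e \in F &
        [/\ s e \in U, t e \in U & x \in chain_points e]].

Lemma chain_in_trans U a b c : chain_in U a b -> chain_in U b c -> chain_in U a c.
Proof.
move=> [l [pl ll inl]] [l' [pl' ll' inl']]; exists (l ++ l'); split.
- by rewrite cat_path pl ll.
- by rewrite last_cat ll.
- move=> x; rewrite -cat_cons mem_cat => /orP[/inl//|xl'].
  by apply: inl'; rewrite in_cons xl' orbT.
Qed.

Lemma chain_in_sym U a b : chain_in U a b -> chain_in U b a.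
Proof.
move=> [l [pl ll inl]]; exists (rev (belast a l)); split.
- rewrite -ll rev_path; apply: sub_path pl => x y; by rewrite closeC.
- by case: l ll {pl inl} => [<-|y l _] //=; rewrite rev_cons last_rcons.
- move=> x xl; apply: inl; rewrite lastI mem_rcons ll in_cons.
  by move: xl; rewrite in_cons mem_rev.
Qed.

Lemma chain_in_edge (U : {set V}) e : e \in F -> s e \in U -> t e \in U ->
  chain_in U (pos (s e)) (pos (t e)).
Proof.
move=> eF se te; exists (rcons (inner e) (pos (t e))); split.
- exact: chainF.
- by rewrite last_rcons.
- by move=> x xe; exists e.
Qed.

Lemma chain_in_adj (U : {set V}) x y : x \in U -> y \in U -> adj x y -> chain_in U (pos x) (pos y).
Proof.
move=> xU yU /exists_inP[e eF /orP[]/andP[/eqP ex /eqP ey]].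
  by rewrite -ex -ey; apply: chain_in_edge; rewrite ?ex ?ey.
by apply: chain_in_sym; rewrite -ex -ey; apply: chain_in_edge; rewrite ?ex ?ey.
Qed.

Lemma chain_in_connect (W U : {set V}) x y c : W \subset U -> connect (adj_in W) x y ->
  chain_in U (pos y) c -> chain_in U (pos x) c.
Proof.
move=> /fintype.subsetP sub /connectP[p]; elim: p x => [|z p IH] x /=; first by move=> _ ->.
move=> /andP[/and3P[xW zW xz] pz] yl cy.
by apply: chain_in_trans (IH _ pz yl cy); apply: chain_in_adj; rewrite ?sub.
Qed.

Definition chains_meet e f := exists a b,
  [/\ a \in chain_points e, b \in chain_points f & close (8 * eps) a b].

(** Two branch sets are joined by a chain between their roots inside their union. Disjoint pairs of
    indices have disjoint unions, so the nearby points found by [K5_chains] lie on edges without a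
    common end. *)
Lemma minor_model_K5 (S T : {set V}) (r : rel V) : minor_model S r -> T \subset S ->
  clique T r -> #|T| = 5 ->
  exists e f, [/\ e \in F, f \in F, disjoint_ends s t e f & chains_meet e f].
Proof.
move=> [B [dis con edg]] /fintype.subsetP TS cT T5.
have [x0 x0T] : exists x, x \in T by apply/card_gt0P; rewrite T5.
pose w i := nth x0 (enum T) i.
have wT i : (i < 5)%N -> w i \in T.
  by move=> i5; rewrite -mem_enum mem_nth // -cardE T5.
have w_inj i j : (i < 5)%N -> (j < 5)%N -> i != j -> w i != w j.
  by move=> i5 j5; apply: contra; rewrite nth_uniq ?enum_uniq // -cardE T5.
have edge i j : (i < 5)%N -> (j < 5)%N -> i != j ->
    exists x y, [/\ x \in B (w i), y \in B (w j) & adj x y].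
  by move=> i5 j5 ij; apply: edg; rewrite ?TS ?cT ?wT ?w_inj.
(* A branch set is nonempty because it is adjacent to another one. *)
have /choice[root rootP] i : exists x, (i < 5)%N -> x \in B (w i).
  case: (ltnP i 5) => i5; last by exists x0.
  have [j [j5 ij]] : exists j, (j < 5)%N /\ i != j.
    by case: (posnP i) => [->|i0]; [exists 1%N|exists 0%N; rewrite -lt0n].
  by have [x [_ [xB _ _]]] := edge _ _ i5 j5 ij; exists x.
pose U (ij : nat * nat) := B (w ij.1) :|: B (w ij.2).
have /choice[l lP] (ij : nat * nat) : exists l, (ij.1 < ij.2 < 5)%N ->
    path (close eps) (pos (root ij.1)) (rcons l (pos (root ij.2))) /\
    forall x, x \in pos (root ij.1) :: rcons l (pos (root ij.2)) -> exists2 e, e \in F &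
        [/\ s e \in U ij, t e \in U ij & x \in chain_points e].
  case: ij => i j /=; case: (boolP (i < j < 5)%N) => [ij|_]; last by exists [::].
  have [i5 j5 nij] : [/\ (i < 5)%N, (j < 5)%N & i != j] by split; lia.
  have [x [y [xB yB xy]]] := edge _ _ i5 j5 nij.
  have c1 : chain_in (U (i, j)) (pos x) (pos y).
    by apply: chain_in_adj; rewrite // !inE /= ?xB ?yB ?orbT.
  have c2 : chain_in (U (i, j)) (pos (root i)) (pos y).
    apply: chain_in_connect (con _ _ _ _ (rootP _ i5) xB) c1; first exact: finset.subsetUl.
    by rewrite TS ?wT.
  have [l [pl ll lin]] : chain_in (U (i, j)) (pos (root i)) (pos (root j)).
    apply: chain_in_sym; apply: chain_in_connect (con _ _ _ _ (rootP _ j5) yB) _.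
    - exact: finset.subsetUr.
    - by rewrite TS ?wT.
    - exact: chain_in_sym.
  exists l => _; split.
    (* [l] already ends at the second root; repeating it adds a step of length 0. *)
    by rewrite rcons_path pl ll /close !subrr normr0 ltW.
  move=> z; rewrite -rcons_cons mem_rcons in_cons => /orP[/eqP->|zl]; apply: lin => //.
  by rewrite -ll mem_last.
have [|i [j [k [m [ij km u [a [b [aij bkm ab]]]]]]]] :=
    @K5_chains _ eps (pos \o root) (fun i j => l (i, j)) eps0.
  by move=> i j ij; have [] := lP (i, j) ij.
have [_ /(_ _ aij)[e eF [se te ae]]] := lP (i, j) ij.
have [_ /(_ _ bkm)[f fF [sf tf bf]]] := lP (k, m) km.
exists e, f; split=> //; last by exists a, b.
have disU x y : x \in U (i, j) -> y \in U (k, m) -> x != y.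
  case/andP: (ij) => /ltn_trans i5 j5; case/andP: (km) => /ltn_trans k5 m5.
  move: i5 k5 => /(_ _ j5) i5 /(_ _ m5) k5.
  move: u; rewrite /= !inE !negb_or -!andbA => /and5P[_ nik nim njk /and3P[njm _ _]].
  have disB i' k' z : (i' < 5)%N -> (k' < 5)%N -> i' != k' ->
      z \in B (w i') -> z \in B (w k') -> False.
    move=> i'5 k'5 ik' zi; apply/negP.
    by rewrite (disjointFr (dis _ _ (TS _ (wT _ i'5)) (TS _ (wT _ k'5)) (w_inj _ _ i'5 k'5
      ik')) zi).
  move=> xU yU; apply/eqP => exy; move: xU yU; rewrite exy.
  by move=> /orP[y1|y1] /orP[y2|y2]; apply: (disB _ _ _ _ _ _ y1 y2).
by rewrite /disjoint_ends !disU.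
Qed.

(** With [t = 3] the degree sum is at most [2 * 7 * #|S|]. Without loops and parallel edges, [g]
    maps the two orientations of all edges injectively to adjacent pairs. *)
Lemma planar_edges (S : {set V}) :
  {in F, forall e, (s e \in S) && (t e \in S)} ->
  {in F &, forall e f, e != f -> ~~ parallel s t e f} ->
  {in F &, forall e f, disjoint_ends s t e f -> ~ chains_meet e f} ->
  (#|F| <= 7 * #|S|)%N.
Proof.
move=> FS nopar nomeet.
have := @minor_closed_edges V 3 minor_model minor_model_subgraph minor_model_contract _
  S adj (minor_model_id S) adj_sym adj_irr.
have noK (S' : {set V}) (r : rel V) (T : {set V}) : minor_model S' r -> T \subset S' ->
  clique T r -> #|T| != 5%N.
  move=> mm TS cT; apply/eqP => T5.
  by have [e [f [eF fF dis /(nomeet _ _ eF fF dis)]]] := minor_model_K5 mm TS cT T5.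
move=> /(_ noK) bound.
pose g (x : E * bool) := if x.2 then (s x.1, t x.1) else (t x.1, s x.1).
have g_inj : {in finset.setX F [set: bool]%SET &, injective g}.
  move=> [e b] [f c] /setXP[eF _] /setXP[fF _]; rewrite /g /=.
  case: (eqVneq e f) => [<-|ef].
    case: b; case: c => //= -[h _]; have := noloop eF; by rewrite h eqxx.
  have := nopar _ _ eF fF ef; rewrite /parallel negb_or.
  by case: b; case: c => /= /andP[h1 h2] [e1 e2]; move: h1 h2; rewrite e1 e2 !eqxx ?andbF.
have : (2 * #|F| <= \sum_(x in S) #|nbhd S adj x|)%N.
  have -> : (2 * #|F| = #|g @: finset.setX F [set: bool]%SET|)%N.
    by rewrite card_in_imset // cardsX cardsT card_bool mulnC.
  have -> : (\sum_(x in S) #|nbhd S adj x| = #|[set p : V * V | [&& p.1 \in S, p.2 \in S &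
    adj p.1 p.2]]%SET|)%N.
    rewrite -sum1_card (eq_bigl (fun p : V * V => (p.1 \in S) && ((p.2 \in S) && adj p.1
      p.2))); last first.
      by move=> p; rewrite inE.
    rewrite -(pair_big_dep (mem S) (fun x y => (y \in S) && adj x y) (fun _ _ => 1%N)) /=.
    apply: eq_bigr => x _; rewrite sum1_card; apply: eq_card => y; by rewrite !inE.
  apply: subset_leq_card; apply/fintype.subsetP => _ /imsetP[[e b] /setXP[eF _] ->].
  have /andP[se te] := FS _ eF; rewrite inE /g.
  case: b => /=; rewrite se te /=; apply/exists_inP; exists e; by rewrite // !eqxx ?orbT.
by move: bound; rewrite /=; lia.
Qed.

End DrawnGraph.

(** * Arcs of curves *)

Local Open Scope classical_set_scope.

Section Arcs.
Variable R : realType.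
Implicit Types (A B : set (R * R)) (g : R -> R * R).

Lemma ball_close (a b : R * R) (r : R) : ball a r b -> close r a b.
Proof. by case=> /ltW h1 /ltW h2; apply/andP. Qed.

Lemma close_ball (a b : R * R) (r r' : R) : close r a b -> r < r' -> ball a r' b.
Proof. by move=> /andP[h1 h2] rr'; split; apply: le_lt_trans rr'. Qed.

Lemma compact_gap A B : compact A -> compact B -> A `&` B = set0 ->
  exists2 r : R, 0 < r & forall a b, A a -> B b -> ~~ close r a b.
Proof.
move=> cA cB AB.
have clB : closed B by apply: compact_closed cB; exact: norm_hausdorff.
have : \forall r \near 0^'+, forall a, A a -> forall b, B b -> ~~ close r a b.
  move/compact_near_coveringP: cA; apply => a Aa.
  have : nbhs a (~` B).
    apply: open_nbhs_nbhs; split; first exact: closed_openC.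
    by move=> Ba; have : set0 a by rewrite -AB.
  move=> /nbhs_ballP[e /= e0 sub].
  near=> a' r; have re : r < e / 2.
    by near: r; apply: nbhs_right_lt; rewrite divr_gt0.
  move=> b Bb; apply/negP => /close_ball cab.
  apply: (sub b) => //; apply: (@ball_split _ _ a').
    by near: a'; apply: nbhsx_ballx; rewrite divr_gt0.
  exact: cab.
move=> nr; near (0 : R)^'+ => r; exists r.
  by near: r; exact: nbhs_right_gt.
suff H : forall a, A a -> forall b, B b -> ~~ close r a b by move=> a b /H; apply.
by near: r.
Unshelve. all: by end_near. Qed.

(** The Heine-Cantor theorem, by the near-covering form of compactness. *)
Lemma uniformly_close g (a b eps : R) : {within `[a, b], continuous g} -> 0 < eps ->
  exists2 r : R, 0 < r &
    forall x y, x \in `[a, b]%R -> y \in `[a, b]%R -> `|x - y| <= r -> close eps (g x) (g y).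
Proof.
move=> cg eps0.
have : \forall r \near 0^'+, forall x, x \in `[a, b]%R -> forall y, y \in `[a, b]%R ->
    `|x - y| <= r -> close eps (g x) (g y).
  have /compact_near_coveringP/near_covering_withinP := @segment_compact R a b.
  move=> /(_ R 0^'+ (fun r x => forall y, y \in `[a, b]%R ->
    `|x - y| <= r -> close eps (g x) (g y)) _) cov; apply: filterS (cov _) => [r H x xab|x
      xab]; first exact: H.
  move/subspace_continuousP: cg => /(_ x xab) /(_ (ball (g x) (eps / 2))).
  have e2 : 0 < eps / 2 by rewrite divr_gt0.
  move=> /(_ (nbhsx_ballx _ _ e2)) /nbhs_ballP[e /= e0 sub].
  near=> x' r; have re : r < e / 2.
    by near: r; apply: nbhs_right_lt; rewrite divr_gt0.
  have xx' : ball x (e / 2) x'.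
    by near: x'; apply: nbhsx_ballx; rewrite divr_gt0.
  move=> x'ab y yab xy.
  have near_x z : z \in `[a, b]%R -> ball x e z -> close (eps / 2) (g x) (g z).
    by move=> zab /sub /(_ zab) /ball_close.
  rewrite (splitr eps); apply: (@close_trans _ _ _ _ (g x)).
    rewrite closeC; apply: near_x => //; apply: le_ball xx'.
    by rewrite ler_pdivrMr // ler_peMr ?ler1n // ltW.
  apply: near_x => //; apply: ball_split xx' _.
  exact: le_lt_trans xy _.
move=> nr; near (0 : R)^'+ => r; exists r.
  by near: r; exact: nbhs_right_gt.
suff H : forall x, x \in `[a, b]%R -> forall y, y \in `[a, b]%R ->
    `|x - y| <= r -> close eps (g x) (g y) by move=> x y /H; apply.
by near: r.
Unshelve. all: by end_near. Qed.

Lemma arc_chain g (a b eps : R) : {within `[a, b], continuous g} -> a <= b -> 0 < eps ->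
  exists l, path (close eps) (g a) (rcons l (g b)) /\
    forall z, z \in g a :: rcons l (g b) -> (g @` `[a, b]) z.
Proof.
move=> cg ab eps0; have [r r0 rP] := uniformly_close cg eps0.
have [N NP] : exists N : nat, b - a <= N%:R * r.
  exists (Num.bound ((b - a) / r)); rewrite -ler_pdivrMr //.
  by rewrite ltW // archi_boundP // divr_ge0 ?subr_ge0 // ltW.
have : forall c, a <= c <= b -> b - c <= N%:R * r ->
    exists l, path (close eps) (g c) (rcons l (g b)) /\
    forall z, z \in g c :: rcons l (g b) -> (g @` `[a, b]) z.
  elim: N {NP} => [|N IH] c /andP[ac cb] bc.
    have cE : c = b by apply/eqP; rewrite eq_le cb -subr_le0; move: bc; rewrite mul0r.
    exists [::]; rewrite cE /= /close !subrr normr0 ltW //; split=> // z.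
    by rewrite !inE orbb => /eqP->; exists b; rewrite //= in_itv /= ab lexx.
  have cI : c \in `[a, b]%R by rewrite in_itv /= ac.
  have bI : b \in `[a, b]%R by rewrite in_itv /= ab lexx.
  case: (lerP (b - c) r) => bcr.
    exists [::]; split.
      by rewrite /= andbT; apply: rP => //; rewrite distrC ger0_norm // subr_ge0.
    by move=> z; rewrite !inE => /orP[]/eqP->; [exists c|exists b].
  have cr : a <= c + r <= b by rewrite (le_trans ac) ?lerDl ?(ltW r0) //=; lra.
  have [|l [pl lP]] := IH _ cr; first by move: bc; rewrite -natr1 mulrDl mul1r; lra.
  exists (g (c + r) :: l); split=> /=.
    rewrite pl andbT; apply: rP => //; rewrite opprD addNKr normrN ger0_norm // ltW //.
  by move=> z; rewrite in_cons => /orP[/eqP->|/lP//]; exists c.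
by move=> /(_ a); rewrite lexx ab; apply.
Qed.

Lemma arc_compact g (a b : R) : {within `[a, b], continuous g} -> compact (g @` `[a, b]).
Proof. by move=> cg; apply: continuous_compact => //; apply: segment_compact. Qed.

End Arcs.

(** * Counting incidences *)

Local Open Scope fset_scope.

Section FiniteCounting.
Variables (T : choiceType) (U : finType).
Implicit Types (A : {fset T}) (Q : pred U) (f : U -> T).

Lemma leq_card_fset Q f A : {in Q &, injective f} -> {in Q, forall u, f u \in A} ->
  (#|Q| <= #|` A|)%N.
Proof.
move=> f_inj fA; rewrite -(size_image f) /=; apply: uniq_leq_size.
  by rewrite map_inj_in_uniq ?enum_uniq // => u u'; rewrite !mem_enum; apply: f_inj.
by move=> _ /fintype.imageP[u Qu ->]; apply: fA.
Qed.

Lemma leq_fset_card Q f A : {in A, forall a, exists2 u, Q u & f u = a} ->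
  (#|` A| <= #|Q|)%N.
Proof.
move=> fA; rewrite -(size_image f); apply: uniq_leq_size; first exact: fset_uniq.
by move=> a /fA[u Qu <-]; apply: fintype.image_f.
Qed.

End FiniteCounting.

Lemma finite_min (R : realType) (I : finType) (Q : I -> R -> Prop) :
  (forall i (r r' : R), r <= r' -> Q i r' -> Q i r) ->
  (forall i, exists2 r : R, 0 < r & Q i r) ->
  exists2 r : R, 0 < r & forall i, Q i r.
Proof.
move=> Qmon ex; have /choice[r rP] i : exists r : R, 0 < r /\ Q i r.
  by have [r r0 Qr] := ex i; exists r.
(* The default 1 keeps the minimum positive when [I] is empty. *)
exists (\big[Num.min/1]_i r i); first by apply: lt_bigmin => // i _; case: (rP i).
by move=> i; apply: Qmon (proj2 (rP i)); exact: (bigmin_inf i).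
Qed.

Section PairSums.
Variables (R : realType) (C : {fset set (R * R)}).

(** A two-element [D] arises from at most two ordered pairs, [x0] and its swap. *)
Lemma sum_pairs_le :
  (\sum_(x : C * C | x.1 != x.2) #|` fset_set (val x.1 `&` val x.2)%classic| <=
   2 * \sum_(D <- fpowerset C | #|` D| == 2%N)
     #|` fset_set (\bigcap_(c in [set` D]) c)%classic|)%N.
Proof.
pose G (D : {fset set (R * R)}) := #|` fset_set (\bigcap_(c in [set` D]) c)%classic|.
pose D2 (x : C * C) : {fset set (R * R)} := [fset val x.1; val x.2].
have GE x : G (D2 x) = #|` fset_set (val x.1 `&` val x.2)%classic|.
  rewrite /G; congr (#|` fset_set _|); apply/seteqP; split=> z /=.
    by move=> zD; split; apply: zD; rewrite /= !inE eqxx ?orbT.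
  by move=> [z1 z2] c /=; rewrite !inE => /orP[]/eqP->.
have D2C x : D2 x \in fpowerset C.
  by rewrite fpowersetE; apply/fsubsetP => c; rewrite !inE => /orP[]/eqP->; apply: valP.
have D2card x : x.1 != x.2 -> #|` D2 x| == 2%N.
  by move=> x12; rewrite cardfs2 (inj_eq val_inj) x12.
apply: leq_trans (_ : \sum_(x : C * C | x.1 != x.2)
    \sum_(D <- fpowerset C | #|` D| == 2%N) (D2 x == D) * G D <= _)%N.
  apply: leq_sum => x x12; rewrite -GE big_mkcond /= (bigD1_seq (D2 x)) ?fset_uniq //=.
  by rewrite D2card // eqxx mul1n leq_addr.
rewrite exchange_big /= big_distrr /=; apply: leq_sum => D _.
rewrite -big_distrl leq_mul2r; apply/orP; right.
case: (pickP (fun x : C * C => (x.1 != x.2) && (D2 x == D))) => [x0 /andP[_ /eqP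
  <-]|none]; last first.
  by rewrite big1 // => x x12; have := none x; rewrite x12 /= => ->.
apply: leq_trans (_ : \sum_(x : C * C | x \in [:: x0; (x0.2, x0.1)]) 1 <= _)%N; last first.
  by rewrite sum1_card; apply: leq_trans (card_size _) _.
rewrite big_mkcond [X in (_ <= X)%N]big_mkcond; apply: leq_sum => -[a b] _ /=.
case: ifP => // ab; case: eqP => // /fsetP DD.
suff -> : (a, b) \in [:: x0; (x0.2, x0.1)] by [].
have := DD (val a); have := DD (val b); rewrite !inE !eqxx !orbT /= => /esym bb /esym aa.
rewrite !(inj_eq val_inj) in aa bb; case: x0 {DD} aa bb => c d /=.
rewrite !xpair_eqE => /orP[]/eqP ac /orP[]/eqP bd; subst; rewrite ?eqxx ?orbT // eqxx in ab *.
Qed.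

End PairSums.

Section Arrangement.
Variables (R : realType) (C : {fset set (R * R)}) (P : {fset R * R}).
Variables (J : C -> set R) (g : C -> R -> R * R) (tau : C -> P -> R) (next : P * C -> P).

Definition inc (x : P * C) : bool := val x.1 \in val x.2.

Definition later (x : P * C) (w : P) : bool :=
  inc (w, x.2) && (tau x.2 x.1 < tau x.2 w).

(** An arc is named by its first point and its curve; the last point of [P] on a curve starts
    none. *)
Definition arcs : {set P * C} := [set x | inc x && [exists w, later x w]]%SET.

Definition arc (x : P * C) : set (R * R) :=
  (g x.2 @` `[tau x.2 x.1, tau x.2 (next x)])%classic.

Hypothesis J_itv : forall k, is_interval (J k).
Hypothesis g_cont : forall k, {within J k, continuous (g k)}.
Hypothesis g_inj : forall k, set_inj (J k) (g k).
Hypothesis g_img : forall k, val k = (g k @` J k)%classic.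
Hypothesis tauP : forall k v, inc (v, k) -> J k (tau k v) /\ g k (tau k v) = val v.
Hypothesis nextP : forall x, x \in arcs -> later x (next x) /\
  forall w, later x w -> tau x.2 (next x) <= tau x.2 w.

Definition arcs_cross (e f : P * C) : bool :=
  disjoint_ends fst next e f && `[< exists z, arc e z /\ arc f z >].

Lemma tau_inj k v w : inc (v, k) -> inc (w, k) -> tau k v = tau k w -> v = w.
Proof.
move=> /tauP[_ ev] /tauP[_ ew] e; apply: val_inj.
by rewrite -[LHS]ev -[RHS]ew e.
Qed.

Lemma arcs_inc v k : (v, k) \in arcs ->
  [/\ inc (v, k), inc (next (v, k), k) & tau k v < tau k (next (v, k))].
Proof.
move=> xA; have [/andP[i2 lt] _] := nextP xA.
by move: xA; rewrite inE => /andP[i1 _].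
Qed.

Lemma arcs_noloop : {in arcs, forall e, e.1 != next e}.
Proof.
case=> v k /arcs_inc[_ _]; apply: contraTneq => /= <-; by rewrite ltxx.
Qed.

Lemma arc_param v k z : (v, k) \in arcs -> arc (v, k) z ->
  exists r, [/\ J k r, g k r = z & tau k v <= r <= tau k (next (v, k))].
Proof.
move=> xA [r] /=; rewrite in_itv /= => rI <-; exists r; split=> //.
have [i1 i2 _] := arcs_inc xA.
by apply: (J_itv (k := k)) rI; [case: (tauP i1)|case: (tauP i2)].
Qed.

Lemma arc_sub v k z : (v, k) \in arcs -> arc (v, k) z -> val k z.
Proof. by move=> xA /(arc_param xA)[r [Jr <- _]]; rewrite g_img; exists r. Qed.

(** By injectivity [w] has its parameter within the arc, and [next] leaves no point of [P] strictly
    between the ends. *)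
Lemma arc_point v k (w : P) : (v, k) \in arcs -> arc (v, k) (val w) ->
  w = v \/ w = next (v, k).
Proof.
move=> xA aw; have [i1 i2 lt] := arcs_inc xA.
have iw : inc (w, k) by rewrite /inc inE; apply: arc_sub xA aw.
have [r [Jr gr /andP[r1 r2]]] := arc_param xA aw.
have [Jw gw] := tauP iw.
have er : r = tau k w by apply: (g_inj (k := k)); rewrite ?inE // gr gw.
move: r1; rewrite er le_eqVlt => /predU1P[/(tau_inj i1 iw)->|vw]; [by left|right].
have [_ /(_ w)] := nextP xA; rewrite /later iw vw /= => /(_ isT) h.
by apply: (tau_inj iw i2); apply/eqP; rewrite eq_le h -er r2.
Qed.

(** [z] has a single parameter, and the parameter intervals of different arcs of a curve share at
    most an end, which belongs to [P]. *)
Lemma arc_unique v v' k z : (v, k) \in arcs -> (v', k) \in arcs ->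
  arc (v, k) z -> arc (v', k) z -> (forall w : P, val w <> z) -> v = v'.
Proof.
move=> vA vA' az az' zP.
have half u u' : (u, k) \in arcs -> (u', k) \in arcs ->
    arc (u, k) z -> arc (u', k) z -> ~~ (tau k u < tau k u').
  move=> uA uA' /(arc_param uA)[r [Jr gr /andP[_ r2]]] /(arc_param uA')[r' [Jr' gr' /andP[r1' _]]].
  have err : r = r' by apply: (g_inj (k := k)); rewrite ?inE // gr gr'.
  apply/negP => uu'; have [iu' _ _] := arcs_inc uA'.
  have [_ /(_ u')] := nextP uA; rewrite /later iu' uu' /= => /(_ isT) h.
  have eq : tau k u' = r by apply/eqP; rewrite eq_le {1}err r1' (le_trans r2 h).
  by apply: (zP u'); have [_ <-] := tauP iu'; rewrite eq.
have [i _ _] := arcs_inc vA; have [i' _ _] := arcs_inc vA'.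
apply: (tau_inj i i'); apply/eqP.
by rewrite eq_le !leNgt !half.
Qed.

Lemma arcs_cross_nopoint e f z : e \in arcs -> f \in arcs ->
  disjoint_ends fst next e f -> arc e z -> arc f z -> forall w : P, val w <> z.
Proof.
case: e => v k; case: f => v' k' eA fA /and4P[/= h1 h2 h3 h4] ez fz w wz.
rewrite -wz in ez fz.
by case: (arc_point eA ez) (arc_point fA fz) => e1 [] e2;
  move: h1 h2 h3 h4; rewrite -e1 -e2 ?eqxx.
Qed.

Lemma arcs_cross_curves e f : e \in arcs -> f \in arcs -> arcs_cross e f -> e.2 != f.2.
Proof.
move=> eA fA /andP[dis /asboolP[z [ez fz]]].
have zP := arcs_cross_nopoint eA fA dis ez fz.
apply/eqP; case: e f eA fA dis ez fz => v k [v' k'] eA fA dis ez fz /= kk; subst k'.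
by move: dis; rewrite (arc_unique eA fA ez fz zP) /disjoint_ends /= eqxx.
Qed.

(** Parallel arcs on one curve coincide, since both run towards larger parameters; so [f] is
    determined by its curve, which passes through both ends of [e]. *)
Lemma parallel_arcs_card e : e \in arcs ->
  (#|[pred f in arcs | parallel fst next e f]| <= max_joint_curves C P)%N.
Proof.
move=> eA; pose A := [fset c in C | (val e.1 \in c) && (val (next e) \in c)].
have AM : (#|` A| <= max_joint_curves C P)%N.
  apply: (@leq_bigmax_seq _ _ _ (fun x : (R * R) * (R * R) =>
    #|` [fset c in C | (x.1 \in c) && (x.2 \in c)]|) (val e.1, val (next e))).
    by rewrite in_fsetM /= !fsvalP.
  by rewrite /= (inj_eq val_inj) arcs_noloop.
apply: leq_trans AM; apply: (@leq_card_fset _ _ _ (fun f : P * C => val f.2)).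
  move=> [v k] [v' k'] /= /andP[fA par] /andP[fA' par'] /val_inj kk; subst k'.
  congr pair; have [_ _ lt] := arcs_inc fA; have [_ _ lt'] := arcs_inc fA'.
  case/orP: par => /= /andP[/eqP e1 /eqP e2]; case/orP: par' => /= /andP[/eqP e1' /eqP e2'].
  - by rewrite -e1 -e1'.
  - by move: lt lt'; rewrite -e2 -e1' e2' e1 => /lt_trans h /h; rewrite ltxx.
  - by move: lt lt'; rewrite -e1 -e2' e2 e1' => /lt_trans h /h; rewrite ltxx.
  - by rewrite -e2 -e2'.
move=> [v k] /= /andP[fA par]; have [i1 i2 _] := arcs_inc fA.
rewrite !inE /= fsvalP /=.
by case/orP: par => /= /andP[/eqP -> /eqP ->]; apply/andP.
Qed.

(** For two given curves, the chosen common point [z] lies outside [P] and so determines both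
    arcs. *)
Lemma arcs_cross_card :
  (forall c1 c2, c1 \in C -> c2 \in C -> c1 != c2 -> finite_set (c1 `&` c2)%classic) ->
  (#|[pred x : (P * C) * (P * C) | (x.1 \in arcs) && (x.2 \in arcs) && arcs_cross x.1 x.2]| <=
   \sum_(x : C * C | x.1 != x.2) #|` fset_set (val x.1 `&` val x.2)%classic|)%N.
Proof.
move=> fin; rewrite -sum1_card.
rewrite (partition_big (fun x : (P * C) * (P * C) => (x.1.2, x.2.2))
    (fun y : C * C => y.1 != y.2)) /=; last first.
  by move=> [e f] /andP[/andP[eA fA]]; apply: arcs_cross_curves.
apply: leq_sum => -[k k'] /= kk'; rewrite sum1_card.
have /choice[z zP] (x : (P * C) * (P * C)) : exists z, arcs_cross x.1 x.2 -> arc x.1 z /\ arc x.2 z.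
  case: (boolP (arcs_cross x.1 x.2)) => [/andP[_ /asboolP[z zx]]|_]; last by exists 0.
  by exists z.
apply: (@leq_card_fset _ _ _ z).
  move=> [[v1 k1] [v1' k1']] [[v2 k2] [v2' k2']]; rewrite !unfold_in /=.
  move=> /andP[/andP[/andP[e1A f1A] x1] /eqP[ek1 ek1']].
  move=> /andP[/andP[/andP[e2A f2A] x2] /eqP[ek2 ek2']] zz.
  move: e1A f1A x1 e2A f2A x2 zz; rewrite ek1 ek1' ek2 ek2' => e1A f1A x1 e2A f2A x2 zz.
  have [z1 z1'] := zP ((v1, k), (v1', k')) x1; have [z2 z2'] := zP ((v2, k), (v2', k')) x2.
  have dis := x1; move: dis => /andP[dis _].
  have zno := arcs_cross_nopoint e1A f1A dis z1 z1'.
  rewrite -zz in z2 z2'.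
  by rewrite (arc_unique e1A e2A z1 z2 zno) (arc_unique f1A f2A z1' z2' zno).
move=> [[v1 k1] [v1' k1']]; rewrite unfold_in /=.
move=> /andP[/andP[/andP[e1A f1A] x1] /eqP[ek1 ek1']].
have [z1 z1'] := zP ((v1, k1), (v1', k1')) x1.
rewrite in_fset_set; last by apply: fin; rewrite ?fsvalP // (inj_eq val_inj).
by rewrite inE -ek1 -ek1'; split; [apply: arc_sub e1A z1|apply: arc_sub f1A z1'].
Qed.

Lemma arc_continuous v k : (v, k) \in arcs ->
  {within `[tau k v, tau k (next (v, k))], continuous (g k)}.
Proof.
move=> xA; apply: continuous_subspaceW (g_cont (k := k)) => r /=; rewrite in_itv /= => rI.
have [i1 i2 _] := arcs_inc xA.
by apply: (J_itv (k := k)) rI; [case: (tauP i1)|case: (tauP i2)].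
Qed.

(** Finitely many arcs admit one gap [r] for all disjoint pairs. With [eps = r / 8], chains that
    come within [8 * eps] lie on arcs that really meet. *)
Lemma arcs_planar (S : {set P}) (F : {set P * C}) : F \subset arcs ->
  {in F, forall e, (e.1 \in S) && (next e \in S)} ->
  {in F &, forall e f, e != f -> ~~ arcs_cross e f && ~~ parallel fst next e f} ->
  (#|F| <= 7 * #|S|)%N.
Proof.
move=> /fintype.subsetP FA FS indep.
have [r r0 rP] : exists2 r : R, 0 < r & forall x : (P * C) * (P * C),
    x.1 \in arcs -> x.2 \in arcs -> (arc x.1 `&` arc x.2)%classic = set0 ->
    forall a b, arc x.1 a -> arc x.2 b -> ~~ close r a b.
  apply: finite_min => [x r r' rr' h e1 e2 e12 a b ha hb|[[v k] [v' k']]].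
    apply: contra (h e1 e2 e12 a b ha hb) => /andP[h1 h2].
    by apply/andP; split; [apply: le_trans h1 rr'|apply: le_trans h2 rr'].
  case: (boolP ((v, k) \in arcs)) => eA; last by exists 1.
  case: (boolP ((v', k') \in arcs)) => fA; last by exists 1.
  case: (pselect ((arc (v, k) `&` arc (v', k'))%classic = set0)) => [ef|nef]; last by exists 1.
  have [r r0 h] := compact_gap (arc_compact (arc_continuous eA)) (arc_compact
    (arc_continuous fA)) ef.
  by exists r.
pose eps := r / 8; have eps0 : 0 < eps by rewrite divr_gt0.
have /choice[inner innerP] (e : P * C) : exists l, e \in arcs ->
    path (close eps) (val e.1) (rcons l (val (next e))) /\
    forall z, z \in val e.1 :: rcons l (val (next e)) -> arc e z.
  case: e => v k; case: (boolP ((v, k) \in arcs)) => eA; last by exists [::].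
  have [i1 i2 lt] := arcs_inc eA; have [_ e1] := tauP i1; have [_ e2] := tauP i2.
  have [l lP] := arc_chain (arc_continuous eA) (ltW lt) eps0.
  by exists l => _; rewrite -e1 -e2.
apply: (@planar_edges R _ _ fst next eps val inner F eps0).
- by move=> e /FA; apply: arcs_noloop.
- by move=> e /FA/innerP[].
- exact: FS.
- by move=> e f eF fF ef; have /andP[] := indep _ _ eF fF ef.
move=> e f eF fF dis [a [b [ae bf ab]]].
have ef : e != f by apply: contraTneq dis => ->; rewrite /disjoint_ends eqxx.
have /andP[/negP nx _] := indep _ _ eF fF ef; apply: nx; rewrite /arcs_cross dis.
have [_ /(_ _ ae) aa] := innerP _ (FA _ eF); have [_ /(_ _ bf) bb] := innerP _ (FA _ fF).
apply/asboolP; apply: contrapT => no.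
have /negP[] : ~~ close r a b.
  apply: (rP (e, f)) => //=; rewrite ?FA //.
  by apply/seteqP; split=> // z [z1 z2]; case: no; exists z.
by have -> : r = 8 * eps by rewrite /eps mulrC divfK.
Qed.

(** An incidence that starts no arc is at the last point of its curve, which is unique. *)
Lemma incidences_arcs : (incidences C P <= #|arcs| + #|` C|)%N.
Proof.
apply: leq_trans (_ : #|[pred x : P * C | inc x]| <= _)%N.
  apply: (leq_fset_card (f := fun x : P * C => (val x.1, val x.2))) => -[a c].
  rewrite !inE /= => /andP[/andP[aP cC] ac].
  by exists ([` aP], [` cC]).
have -> : #|[pred x : P * C | inc x]| =
    (#|arcs| + #|[pred x : P * C | inc x && (x \notin arcs)]|)%N.
  rewrite -[LHS](cardID (mem arcs)); congr addn; apply: eq_card => x; rewrite !inE.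
    by case: (inc x); case: [exists _, _].
  by rewrite andbC.
rewrite leq_add2l cardfE; rewrite -(card_in_image (f := fun x : P * C => x.2)).
  exact: max_card.
move=> [v k] [v' k']; rewrite !inE /= => /andP[i1 l1] /andP[i2 l2] kk; subst k'.
rewrite i1 i2 /= in l1 l2.
congr pair; apply: (tau_inj i1 i2); apply/eqP; rewrite eq_le !leNgt.
move/existsPn: l1 => /(_ v'); move/existsPn: l2 => /(_ v).
by rewrite /later /= i1 i2 /= => -> ->.
Qed.

End Arrangement.

(** * The incidence bound *)

Lemma arcs_bound (R : realType) (C : {fset set (R * R)}) (P : {fset R * R}) :
  (forall c, c \in C -> non_self_crossing_curve c) ->
  (forall c1 c2, c1 \in C -> c2 \in C -> c1 != c2 -> finite_set (c1 `&` c2)%classic) ->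
  exists e : nat,
  [/\ (incidences C P <= e + #|` C|)%N &
    (56 * max_joint_curves C P * #|` P| < e)%N ->
    (e ^ 3 <= 19 ^ 3 * max_joint_curves C P * #|` P| ^ 2 *
      (2 * \sum_(D <- fpowerset C | #|` D| == 2%N)
         #|` fset_set (\bigcap_(c in [set` D]) c)%classic|))%N].
Proof.
move=> curves fin.
have /choice[Jg JgP] (k : C) : exists Jg : set R * (R -> R * R),
    [/\ is_interval Jg.1, {within Jg.1, continuous Jg.2}, set_inj Jg.1 Jg.2 &
        val k = (Jg.2 @` Jg.1)%classic].
  by have [J [g []]] := curves _ (fsvalP k); exists (J, g).
pose J k := (Jg k).1; pose g k := (Jg k).2.
have J_itv k : is_interval (J k) by case: (JgP k).
have g_cont k : {within J k, continuous (g k)} by case: (JgP k).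
have g_inj k : set_inj (J k) (g k) by case: (JgP k).
have g_img k : val k = (g k @` J k)%classic by case: (JgP k).
have /choice[tau' tau'P] (x : C * P) : exists r, inc (x.2, x.1) -> J x.1 r /\ g x.1 r = val x.2.
  case: (boolP (inc (x.2, x.1))) => [|_]; last by exists 0.
  by rewrite /inc inE /= g_img => -[r Jr gr]; exists r.
pose tau k v := tau' (k, v).
have tauP k v : inc (v, k) -> J k (tau k v) /\ g k (tau k v) = val v by apply: (tau'P (k, v)).
have /choice[next nextP] (x : P * C) : exists w, x \in arcs tau -> later tau x w /\
    forall w', later tau x w' -> tau x.2 w <= tau x.2 w'.
  case: (boolP (x \in arcs tau)) => [|_]; last by exists x.1.
  rewrite inE => /andP[_ /existsP[w0 l0]].
  case: (Order.TotalTheory.arg_minP (fun w => tau x.2 w) l0) => w lw wmin.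
  by exists w.
exists #|arcs tau|; split.
  exact: (incidences_arcs tauP).
move=> big; apply: leq_trans (_ : 19 ^ 3 * max_joint_curves C P * #|` P| ^ 2 *
  #|[pred x : (P * C) * (P * C) | (x.1 \in arcs tau) && (x.2 \in arcs tau) &&
     arcs_cross g tau next x.1 x.2]| <= _)%N; last first.
  rewrite leq_mul2l; apply/orP; right; apply: leq_trans (sum_pairs_le C).
  exact: (arcs_cross_card J_itv g_inj g_img tauP nextP fin).
rewrite [#|` P|]cardfE in big *.
apply: (@crossing_lemma _ _ fst next _ R) => //.
- exact: (arcs_noloop nextP).
- by move=> e f /andP[].
- exact: (parallel_arcs_card nextP).
- exact: (arcs_planar J_itv g_cont tauP nextP).
Qed.

Theorem theorem2 (R : realType) :
  exists2 K : R, 0 < K &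
  forall (l p : nat) (C : {fset set (R * R)}) (P : {fset R * R}),
    #|` C| = l -> (2 <= l)%N ->
    #|` P| = p ->
    (forall c, c \in C -> non_self_crossing_curve c) ->
    (forall c1 c2, c1 \in C -> c2 \in C -> c1 != c2 ->
       finite_set (c1 `&` c2)%classic) ->
    let m1 : R := (max_joint_curves C P)%:R in
    let m2 : R := avg_intersection C in
    (incidences C P)%:R <=
      K * ((m1 * m2) `^ (1 / 3) * (p%:R * l%:R) `^ (2 / 3)
           + l%:R + m1 * p%:R).
Proof.
(* 56 covers both cases: [e <= 56 * m1 * p] below the threshold of the crossing lemma, and
   [e <= 19 * X] above it. *)
exists 56; first by rewrite ltr0n.
move=> l p C P Cl l2 Pp curves fin; cbv zeta.
set m1 : R := (max_joint_curves C P)%:R; set m2 := avg_intersection C.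
have [e [Ie ecross]] := arcs_bound P curves fin.
rewrite Cl Pp in Ie ecross.
set N := (\sum_(D <- fpowerset C | _) _)%N in ecross.
have bin0 : (0 : R) < 'C(l, 2)%:R by rewrite ltr0n bin_gt0.
have NE : 'C(l, 2)%:R * m2 = N%:R.
  by rewrite /m2 /avg_intersection Cl mulrA divff ?gt_eqF // mul1r /N natr_sum.
have m2_ge0 : 0 <= m2 by rewrite -(pmulr_rge0 _ bin0) NE ler0n.
have m1_ge0 : 0 <= m1 by rewrite ler0n.
(* The left side is [l * (l - 1) * m2]. *)
have N_le : (2 * N)%:R <= l%:R ^+ 2 * m2 :> R.
  rewrite natrM -NE mulrA ler_wpM2r // -natrM -natrX ler_nat.
  by rewrite -(mul_bin_diag l 1) bin1 -mulnn leq_mul2l leq_pred orbT.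
set X := _ `^ _ * _ `^ _.
have X0 : 0 <= X by rewrite mulr_ge0 ?powR_ge0.
have X3 : X ^+ 3 = m1 * m2 * (p%:R * l%:R) ^+ 2.
  rewrite /X exprMn; congr (_ * _).
    rewrite -powR_mulrn; last exact: powR_ge0.
    by rewrite -powRrM divfK // powRr1 // mulr_ge0.
  rewrite -[_ ^+ 3]powR_mulrn; last exact: powR_ge0.
  by rewrite -powRrM divfK // powR_mulrn // mulr_ge0.
clearbody X; have IeR : ((incidences C P)%:R <= e%:R + l%:R :> R)%R by rewrite -natrD ler_nat.
have l0 : (0 : R) <= l%:R by []. have p0 : (0 : R) <= p%:R by [].
have mp0 : 0 <= m1 * p%:R by rewrite mulr_ge0.
apply: (le_trans IeR).
case: (leqP e (56 * max_joint_curves C P * p)%N) => [small|/ecross big].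
  have : e%:R <= 56 * (m1 * p%:R) by rewrite /m1 -!natrM ler_nat mulnA.
  by lra.
have : e%:R <= 19 * X.
  rewrite -(@ler_pXn2r _ 3) ?nnegrE ?mulr_ge0 //.
  rewrite exprMn X3; apply: (@le_trans _ _ (19 ^+ 3 * m1 * p%:R ^+ 2 * (2 * N)%:R)).
    by move: big; rewrite -(ler_nat R) natrX 3!natrM !natrX.
  have -> : 19 ^+ 3 * (m1 * m2 * (p%:R * l%:R) ^+ 2) = 19 ^+ 3 * m1 * p%:R ^+ 2 * (l%:R ^+ 2 * m2).
    by ring.
  by rewrite ler_wpM2l // !mulr_ge0 ?exprn_ge0.
lra.
Qed.
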